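(* Let $N$ be a smooth compact manifold with boundary, $M=\mathbb{R}\times N$, $m>0$, and let $g=g_{h,\omega,\lambda}$ and $g'=g_{h',\omega',\lambda'}$ be two standard stationary metrics on $M$ with $h|_{\partial N}=h'|_{\partial N}$, $i^*\omega=i^*\omega'$ and $\lambda|_{\partial N}=\lambda'|_{\partial N}$, where $i\colon\partial N\to N$ is the inclusion. Suppose there are a diffeomorphism $f\colon N\to N$ fixing $\partial N$ pointwise and a function $\varphi\in C^\infty(N)$ vanishing on $\partial N$ such that $$h'=f^*h,\qquad \omega'=f^*\omega+d\varphi,\qquad \frac1{\lambda'}=\frac1{f^*\lambda}.$$ Then $\mathcal S_{\rho,m}=\mathcal S_{\rho,m}'$ for all $\rho\in\mathbb{R}$ satisfying $\lambda<\rho^2/m^2$ on $N$, where $\mathcal S_{\rho,m}$, $\mathcal S'_{\rho,m}$ are the scattering relations of momentum $\rho$ and mass $m$ of $(M,g)$ and $(M,g')$.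
   Context: Standard stationary metrics. $h$ is a smooth Riemannian metric on $N$, $\omega$ a smooth 1-form on $N$, $\lambda\in C^\infty(N)$ strictly positive, and $g_{h,\omega,\lambda}=-\lambda(dt-\omega)^2+h$ on $M=\mathbb{R}\times N$ (with coordinate $t$ on $\mathbb{R}$), a Lorentzian metric. $\partial M=\mathbb{R}\times\partial N$. The field $\partial_t$ is Killing, so $(\partial_t,\dot\gamma)_g$ is constant along every geodesic $\gamma$. Scattering relation of momentum $\rho$ and mass $m$. Let $p\in\partial M$ and $v'\in T_p\partial M$ be such that there is $v\in T_pM$ with $(v,v)_g=-m^2$, $(\partial_t,v)_g=\rho$, pointing strictly into the interior of $M$, whose $g$-orthogonal projection on $T_p\partial M$ is $v'$ (such $v$ is then unique). Let $\gamma_{p,v}$ be the geodesic of $(M,g)$ issued from $(p,v)$, let $q$ be the point where it meets $\partial M$ next (if it does), and let $w'$ be the $g$-orthogonal projection on $T_q\partial M$ of its velocity there. Then $\mathcal S_{\rho,m}(p,v')=(q,w')$. Equality $\mathcal S_{\rho,m}=\mathcal S_{\rho,m}'$ is equality as (partially defined) maps. *)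

(* Defs.v *)
From HB Require Import structures.
From mathcomp Require Import all_boot all_order all_algebra.
From mathcomp Require Import all_classical all_reals all_analysis.
Import Order.TTheory GRing.Theory Num.Theory numFieldNormedType.Exports.

Set Implicit Arguments.
Unset Strict Implicit.
Unset Printing Implicit Defensive.

Local Open Scope classical_set_scope.
Local Open Scope ring_scope.

(** * Calculus on subsets of normed spaces *)

Section Calculus.
Context {R : realType}.

Fixpoint ntimes_differentiable (V W : normedModType R) (k : nat)
    (U : set V) (f : V -> W) : Prop :=
  if k is k'.+1 then
    (forall x, U x -> differentiable f x) /\
    (forall v, ntimes_differentiable k' U ('D_v f))
  else True.

(** A map is smooth on an arbitrary set [A] if, near each point of [A], it
    is the restriction to [A] of a smooth map defined on an open set. *)
Definition smooth_on (V W : normedModType R) (A : set V) (f : V -> W) : Prop :=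
  forall a, A a -> exists (U : set V) (g : V -> W),
    [/\ open U, U a, (forall k, ntimes_differentiable k U g)
      & forall x, (U `&` A) x -> f x = g x].

(** The increment [t] tends to 0 from the right: in a half-space
    [0 <= y 0 0] the points [y + t e_k] with [t > 0] never leave the
    half-space, so that this is meaningful up to the boundary.  For functions
    that are [smooth_on] a relatively open subset of the half-space it is the
    partial derivative of any smooth extension. *)
Definition partial (W : normedModType R) (d : nat) (k : 'I_d)
    (f : 'rV[R]_d -> W) (y : 'rV[R]_d) : W :=
  lim ((fun t : R => t^-1 *: (f (y + t *: delta_mx 0 k) - f y)) @ 0^'+).

(** Row-vector convention: the differential is [v |-> v *m jac f y]. *)
Definition jac (d e : nat) (f : 'rV[R]_d -> 'rV[R]_e) (y : 'rV[R]_d) :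
    'M[R]_(d, e) :=
  \matrix_(k, l) partial k (fun z => f z 0 l) y.

(** Christoffel symbol of the second kind [Gamma^k_ab]. *)
Definition christoffel (d : nat) (G : 'rV[R]_d -> 'M[R]_d) (y : 'rV[R]_d)
    (k a b : 'I_d) : R :=
  2^-1 * \sum_l invmx (G y) k l *
    (partial a (fun z => G z b l) y + partial b (fun z => G z a l) y
     - partial l (fun z => G z a b) y).

Definition has_deriv_within (W : normedModType R) (A : set R) (c : R -> W)
    (s : R) (w : W) : Prop :=
  (fun u : R => (u - s)^-1 *: (c u - c s)) @ within A s^' --> w.

End Calculus.

(** * Manifolds with boundary *)

Definition halfspace (R : realType) (n : nat) : set 'rV[R]_n.+1 :=
  [set y | 0 <= y 0 0].

(** Smooth manifolds with boundary of dimension [n.+1], given by a smooth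
    atlas of charts into the half-space. *)
Record bmanifold (R : realType) (n : nat) := BManifold {
  mspace :> topologicalType;
  mhausdorff : hausdorff_space mspace;
  msecond_countable : @second_countable mspace;
  midx : Type;
  mdom : midx -> set mspace;
  mchart : midx -> mspace -> 'rV[R]_n.+1;
  minv : midx -> 'rV[R]_n.+1 -> mspace;
  mdom_open : forall i, open (mdom i);
  mdom_cover : forall x, exists i, mdom i x;
  mimage_open : forall i, exists2 U : set 'rV[R]_n.+1, open U &
    mchart i @` mdom i = U `&` @halfspace R n;
  mchartK : forall i x, mdom i x -> minv i (mchart i x) = x;
  mchart_continuous : forall i, {within mdom i, continuous (mchart i)};
  minv_continuous : forall i,
    {within mchart i @` mdom i, continuous (minv i)};
  mtransition_smooth : forall i j,
    smooth_on (mchart i @` (mdom i `&` mdom j)) (mchart j \o minv i)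
}.

Section Manifold.
Context {R : realType} {n : nat} (N : bmanifold R n).

Definition chart_at (x : N) : midx N := projT1 (cid (mdom_cover x)).

Definition mboundary : set N :=
  [set x | exists2 i, mdom i x & mchart i x 0 0 = 0].

(** [T_x N] is identified with [R^(n+1)] by means of the chart [chart_at x];
    [tcoord x i xi] is the vector of components, in the chart [i], of the
    tangent vector at [x] with components [xi] in the chart [chart_at x]. *)
Definition tcoord (x : N) (i : midx N) (xi : 'rV[R]_n.+1) : 'rV[R]_n.+1 :=
  xi *m jac (mchart i \o minv (chart_at x)) (mchart (chart_at x) x).

(** For [x] in the boundary, [chart_at x] maps [x] to [y 0 0 = 0], so that
    [T_x (boundary)] is the hyperplane of vectors with vanishing component of
    index 0, and the vectors pointing strictly inwards are those for which
    this component is positive. *)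
Definition tangent_to_boundary (xi : 'rV[R]_n.+1) : Prop := xi 0 0 = 0.
Definition strictly_inward (xi : 'rV[R]_n.+1) : Prop := 0 < xi 0 0.

Definition smooth_fun (u : N -> R) : Prop :=
  forall i, smooth_on (mchart i @` mdom i) (u \o minv i).

Definition smooth_map (f : N -> N) : Prop :=
  continuous f /\
  forall i j, smooth_on (mchart i @` (mdom i `&` f @^-1` mdom j))
                        (mchart j \o f \o minv i).

Definition diffeomorphism (f : N -> N) : Prop :=
  smooth_map f /\
  exists f' : N -> N, [/\ smooth_map f', cancel f f' & cancel f' f].

(** Covariant tensors are given by their components [T i x] in each chart [i],
    at the points [x] of its domain; values outside the domain are junk. *)
Definition transition_jac (i j : midx N) (x : N) : 'M[R]_n.+1 :=
  jac (mchart j \o minv i) (mchart i x).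

Definition one_form (om : midx N -> N -> 'cV[R]_n.+1) : Prop :=
  (forall i j x, mdom i x -> mdom j x ->
     om i x = transition_jac i j x *m om j x) /\
  (forall i, smooth_on (mchart i @` mdom i) (om i \o minv i)).

Definition riemannian_metric (h : midx N -> N -> 'M[R]_n.+1) : Prop :=
  [/\ forall i j x, mdom i x -> mdom j x ->
        h i x = transition_jac i j x *m h j x *m (transition_jac i j x)^T,
      forall i x, mdom i x -> (h i x)^T = h i x,
      forall i x (xi : 'rV[R]_n.+1), mdom i x -> xi != 0 ->
        0 < (xi *m h i x *m xi^T) 0 0
    & forall i, smooth_on (mchart i @` mdom i) (h i \o minv i)].

Definition map_jac (f : N -> N) (i : midx N) (x : N) : 'M[R]_n.+1 :=
  jac (mchart (chart_at (f x)) \o f \o minv i) (mchart i x).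

Definition pullback_metric (f : N -> N) (h : midx N -> N -> 'M[R]_n.+1)
    (i : midx N) (x : N) : 'M[R]_n.+1 :=
  map_jac f i x *m h (chart_at (f x)) (f x) *m (map_jac f i x)^T.

Definition pullback_form (f : N -> N) (om : midx N -> N -> 'cV[R]_n.+1)
    (i : midx N) (x : N) : 'cV[R]_n.+1 :=
  map_jac f i x *m om (chart_at (f x)) (f x).

Definition differential (u : N -> R) (i : midx N) (x : N) : 'cV[R]_n.+1 :=
  \col_k partial k (u \o minv i) (mchart i x).

Definition pairing (om : midx N -> N -> 'cV[R]_n.+1) (x : N)
    (xi : 'rV[R]_n.+1) : R := (xi *m om (chart_at x) x) 0 0.

End Manifold.

(** * The spacetime [M = R x N] *)

Section Stationary.
Context {R : realType} {n : nat} (N : bmanifold R n).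

(** Points of [M] are pairs [(t, x)]; a tangent vector at [(t, x)] is a pair
    [(tau, xi)], standing for [tau d/dt + xi] with [xi] in [T_x N]. *)
Definition spacetime := (R * N)%type.
Definition tspace := (R * 'rV[R]_n.+1)%type.

(** The charts of [M] are the products of the identity of [R] with the charts
    of [N]; the coordinate of index 0 is [t]. *)
Definition coordM (i : midx N) (p : spacetime) : 'rV[R]_(1 + n.+1) :=
  row_mx p.1%:M (mchart i p.2).

Definition tcoordM (i : midx N) (p : spacetime) (v : tspace) :
    'rV[R]_(1 + n.+1) :=
  row_mx v.1%:M (tcoord p.2 i v.2).

Definition partial_t : tspace := (1, 0).

Variables (h : midx N -> N -> 'M[R]_n.+1) (om : midx N -> N -> 'cV[R]_n.+1)
  (lam : N -> R).

(** Matrix of [- lam (dt - om)^2 + h] in the chart [i] of [M]. *)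
Definition stationary_metric (i : midx N) (x : N) : 'M[R]_(1 + n.+1) :=
  let alpha : 'cV[R]_(1 + n.+1) := col_mx 1%:M (- om i x) in
  - lam x *: (alpha *m alpha^T) + block_mx 0 0 0 (h i x).

Definition gform (p : spacetime) (v w : tspace) : R :=
  let i := chart_at p.2 in
  (row_mx v.1%:M v.2 *m stationary_metric i p.2 *m (row_mx w.1%:M w.2)^T) 0 0.

Definition stationary_christoffel (i : midx N) :=
  christoffel (fun y : 'rV[R]_(1 + n.+1) =>
    stationary_metric i (minv i (rsubmx y))).

(** [gam], with velocity [V], is a geodesic of [M] on [[0, L]]:
    [y' = V] and [V'^k = - Gamma^k_ab V^a V^b] in every chart. *)
Definition geodesic (L : R) (gam : R -> spacetime) (V : R -> tspace) : Prop :=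
  {within `[0, L], continuous gam} /\
  forall (s : R) (i : midx N), s \in `[0, L] -> mdom i (gam s).2 ->
    let y u := coordM i (gam u) in
    let y' u := tcoordM i (gam u) (V u) in
    has_deriv_within `[0, L] y s (y' s) /\
    has_deriv_within `[0, L] y' s
      (\row_k - \sum_a \sum_b
         stationary_christoffel i (y s) k a b * y' s 0 a * y' s 0 b).

(** [v'] is the [g]-orthogonal projection of [v] on [T_p (boundary of M)]. *)
Definition boundary_projection (p : spacetime) (v v' : tspace) : Prop :=
  tangent_to_boundary v'.2 /\
  forall w : tspace, tangent_to_boundary w.2 ->
    gform p (v.1 - v'.1, v.2 - v'.2) w = 0.

(** Graph of the scattering relation of momentum [rho] and mass [m], a
    partially defined map sending [(p, v')] to [(q, w')]. *)
Definition scattering (rho m : R) :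
    set ((spacetime * tspace) * (spacetime * tspace)) :=
  [set z | let: ((p, v'), (q, w')) := z in
    exists (v : tspace) (L : R) (gam : R -> spacetime) (V : R -> tspace),
    [/\ @mboundary R n N p.2,
        gform p v v = - m ^+ 2,
        gform p partial_t v = rho,
        strictly_inward v.2
      & boundary_projection p v v'] /\
    [/\ 0 < L, geodesic L gam V, gam 0 = p & V 0 = v] /\
    [/\ gam L = q, @mboundary R n N q.2,
        (forall s, 0 < s < L -> ~ @mboundary R n N (gam s).2)
      & boundary_projection q (V L) w']].

End Stationary.

(* Main.v *)
(** The diffeomorphism [F (t, x) = (t - phi x, f x)] of [M] satisfies
    [F^* (dt - om) = dt - om'], hence [F^* g = g'], and it fixes the boundary of
    [M] pointwise.  At a boundary point its differential is the identity on
    boundary vectors and maps inward vectors to inward ones, so that [F] turns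
    each geodesic counted in the scattering relation of [g'] into one counted in
    that of [g], with the same data at both ends; the converse inclusion is the
    same statement for [f^-1] and [- phi \o f^-1].  That isometries preserve
    geodesics is checked on the Euler-Lagrange form of the geodesic equation,
    where the second derivatives of [F] cancel by their symmetry. *)

Require Import Defs.
From HB Require Import structures.
From mathcomp Require Import all_boot all_order all_algebra.
From mathcomp Require Import all_classical all_reals all_analysis.
From mathcomp Require Import ring.
Import Order.TTheory GRing.Theory Num.Theory numFieldNormedType.Exports.

Set Implicit Arguments.
Unset Strict Implicit.
Unset Printing Implicit Defensive.

Local Open Scope classical_set_scope.
Local Open Scope ring_scope.

(** * Derivatives relative to a set *)

(** The curves counted in a scattering relation start and end on the boundary, where charts only
    fill a half-space and [partial] is a one-sided limit. Derivatives are therefore taken relative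
    to a set, and a value of [partial] is computed only from such a derivative. Two orders of
    differentiability suffice: for velocity [v] and acceleration [a], the image curve has velocity
    [v J] and acceleration [a J + v DJ(v)], with [J] the Jacobian of [F]. The image must satisfy its
    equation in every chart, so the pullback identities are first carried to arbitrary pairs of
    charts. Transition maps are treated as local expressions of the identity, so that one chain rule
    serves both for them and for [f]. Christoffel symbols would drag the inverse metric through the
    comparison of accelerations; multiplying by the metric removes it and leaves an identity between
    expressions quadratic in the velocity. *)

Section DerOn.
Context {R : realType}.

(* With [A] a half-space this is the derivative up to the boundary, with [A] an
   interval the derivative of a curve up to its end points. *)
Definition der_on (V W : normedModType R) (A : set V) (f : V -> W) (a : V)
    (L : V -> W) : Prop :=
  [/\ linear L, exists C, forall x, `|L x| <= C * `|x|
    & forall e, 0 < e ->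
        \forall z \near a, A z -> `|f z - f a - L (z - a)| <= e * `|z - a|].

Section Generic.
Variables (V W : normedModType R) (A : set V).
Implicit Types (f g : V -> W) (a : V) (L M : V -> W).

Lemma linear0f L : linear L -> L 0 = 0.
Proof. by move=> /(_ (-1) 0 0); rewrite scaler0 addr0 scaleN1r addNr. Qed.

Lemma linearDf L : linear L -> {morph L : x y / x + y}.
Proof. by move=> lL x y; have := lL 1 x y; rewrite !scale1r. Qed.

Lemma linearZf L : linear L -> forall k x, L (k *: x) = k *: L x.
Proof. by move=> lL k x; have := lL k x 0; rewrite !addr0 linear0f// addr0. Qed.

Lemma linear_sumf L : linear L -> forall (I : Type) (r : seq I) (P : pred I) F,
  L (\sum_(i <- r | P i) F i) = \sum_(i <- r | P i) L (F i).
Proof.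
by move=> lL I r P F; rewrite (big_morph L (linearDf lL) (linear0f lL)).
Qed.

Lemma eq_der_on f a L M : L =1 M -> der_on A f a L -> der_on A f a M.
Proof. by move=> /funext ->. Qed.

Lemma bound_pos L : (exists C, forall x, `|L x| <= C * `|x|) ->
  exists2 C, 0 < C & forall x, `|L x| <= C * `|x|.
Proof.
move=> [C hC]; exists (`|C| + 1); first by rewrite ltr_wpDl.
move=> x; apply: le_trans (hC x) _; rewrite ler_wpM2r//.
by rewrite (le_trans (ler_norm _))// lerDl.
Qed.

Lemma der_on_near f g a L : A a -> (\forall z \near a, A z -> f z = g z) ->
  der_on A f a L -> der_on A g a L.
Proof.
move=> Aa fg [lL bL fL]; split=> // e e0.
have ga : f a = g a by apply: (nbhs_singleton fg).
near=> z => Az.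
have <- : f z = g z by move: Az; near: z.
by rewrite -ga; move: Az; near: z; exact: fL.
Unshelve. all: by end_near. Qed.

Lemma der_on_lipschitz f a L : der_on A f a L ->
  exists2 C, 0 < C & \forall z \near a, A z -> `|f z - f a| <= C * `|z - a|.
Proof.
move=> [_ /bound_pos[C C0 hC] fL]; exists (C + 1); first exact: addr_gt0.
near=> z => Az.
rewrite -[X in `|X|](subrK (L (z - a))) (le_trans (ler_normD _ _))//.
rewrite mulrDl addrC lerD//.
by move: Az; near: z; exact: fL.
Unshelve. all: by end_near. Qed.

Lemma der_on_cvg f a L : der_on A f a L ->
  forall e, 0 < e -> \forall z \near a, A z -> `|f z - f a| < e.
Proof.
move=> /der_on_lipschitz[C C0 hC] e e0; near=> z => Az.
have /(_ Az) h : A z -> `|f z - f a| <= C * `|z - a| by near: z.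
apply: le_lt_trans h _.
rewrite -ltr_pdivlMl//.
near: z; rewrite !near_simpl; apply/nbhs_normP; exists (C^-1 * e) => /=.
  by rewrite mulr_gt0// invr_gt0.
by move=> z /=; rewrite distrC.
Unshelve. all: by end_near. Qed.

Lemma der_on_cst (c : W) a : der_on A (cst c) a (cst 0).
Proof.
split; first by move=> k x y; rewrite /cst scaler0 addr0.
  by exists 0 => x; rewrite normr0 mul0r.
by move=> e e0; near=> z => _; rewrite subrr subr0 normr0 mulr_ge0// ltW.
Unshelve. all: by end_near. Qed.

Lemma der_onD f g a L M : der_on A f a L -> der_on A g a M ->
  der_on A (fun z => f z + g z) a (fun x => L x + M x).
Proof.
move=> [lL [C hC] fL] [lM [D hD] gM]; split.
- by move=> k x y; rewrite lL lM scalerDr addrACA.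
- by exists (C + D) => x; rewrite (le_trans (ler_normD _ _))// mulrDl lerD.
- move=> e e0; have e20 : 0 < e / 2 by rewrite divr_gt0.
  near=> z => Az.
  rewrite 2!opprD (addrACA (f z)) (addrACA (f z - f a)).
  rewrite (le_trans (ler_normD _ _))// [e in leRHS]splitr mulrDl.
  by apply: lerD; move: Az; near: z; [exact: fL e20|exact: gM e20].
Unshelve. all: by end_near. Qed.

Lemma der_onZ k f a L : der_on A f a L ->
  der_on A (fun z => k *: f z) a (fun x => k *: L x).
Proof.
move=> [lL [C hC] fL]; split.
- by move=> j x y; rewrite lL scalerDr !scalerA mulrC.
- by exists (`|k| * C) => x; rewrite normrZ -mulrA ler_wpM2l.
- move=> e e0; have k0 : 0 < `|k| + 1 by rewrite ltr_wpDl.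
  near=> z => Az; rewrite -!scalerBr normrZ.
  have /(_ Az) h : A z -> `|f z - f a - L (z - a)| <= e / (`|k| + 1) * `|z - a|.
    by near: z; apply: fL; rewrite divr_gt0.
  rewrite (le_trans (ler_wpM2l _ h))// mulrA ler_wpM2r//.
  rewrite mulrCA ler_piMr ?(ltW e0)// ler_pdivrMr// mul1r lerDl//.
Unshelve. all: by end_near. Qed.

Lemma der_onN f a L : der_on A f a L ->
  der_on A (fun z => - f z) a (fun x => - L x).
Proof.
move=> /(der_onZ (-1)).
rewrite (_ : (fun z => -1 *: f z) = (fun z => - f z)); last first.
  by apply/funext => z; rewrite scaleN1r.
by apply: eq_der_on => x; rewrite scaleN1r.
Qed.

Lemma der_on_sum (I : Type) (r : seq I) (F : I -> V -> W) a (L : I -> V -> W) :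
  (forall i, der_on A (F i) a (L i)) ->
  der_on A (fun z => \sum_(i <- r) F i z) a (fun x => \sum_(i <- r) L i x).
Proof.
move=> FL; elim: r => [|i r IH].
  rewrite (_ : (fun z => _) = cst 0); last first.
    by apply/funext => z; rewrite big_nil.
  by apply: eq_der_on (der_on_cst 0 a) => x; rewrite big_nil.
rewrite (_ : (fun z => _) = (fun z => F i z + \sum_(j <- r) F j z)).
  by apply: eq_der_on (der_onD (FL i) IH) => x; rewrite big_cons.
by apply/funext => z; rewrite big_cons.
Qed.

Lemma linear_bound_der_on L a : linear L -> (exists C, forall x, `|L x| <= C * `|x|) ->
  der_on A L a L.
Proof.
move=> lL bL; split=> // e e0; near=> z => _.
have -> : L z = L (z - a) + L a by rewrite -linearDf// subrK.
by rewrite addrK subrr normr0 mulr_ge0// ltW.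
Unshelve. all: by end_near. Qed.

End Generic.

(** The error is that of [g] at the increment of [f], plus [M] applied to the error of [f]; the
    Lipschitz bound of [f] controls the first. *)
Lemma der_on_comp (U V W : normedModType R) (A : set U) (B : set V)
    (f : U -> V) (g : V -> W) a L M :
  der_on A f a L -> der_on B g (f a) M -> (\forall z \near a, A z -> B (f z)) ->
  der_on A (g \o f) a (M \o L).
Proof.
move=> fL gM AB.
have [C C0 fC] := der_on_lipschitz fL.
have fc := der_on_cvg fL.
case: fL gM => lL [CL hCL] fL [lM /bound_pos[D D0 hD] gM]; split.
- by move=> k x y; rewrite /= lL lM.
- exists (D * CL) => x /=; rewrite (le_trans (hD _))// -mulrA ler_wpM2l//.
  exact: ltW.
- move=> e e0.
  (* [C] bounds the increments of [f] and [D] the map [M], so the two errors add up to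
     [e1 * C + D * e1 = e]. *)
  pose e1 := e / (C + D).
  have e10 : 0 < e1 by rewrite divr_gt0// addr_gt0.
  have /nbhs_normP[r /= r0 gr] := gM _ e10.
  near=> z => Az /=.
  have Bf : B (f z) by move: Az; near: z.
  have fCz : `|f z - f a| <= C * `|z - a| by move: Az; near: z.
  have gz : `|g (f z) - g (f a) - M (f z - f a)| <= e1 * `|f z - f a|.
    apply: gr => //=; rewrite distrC; move: Az; near: z; exact: fc.
  have fz : `|f z - f a - L (z - a)| <= e1 * `|z - a|.
    by move: Az; near: z; exact: fL.
  rewrite -[X in `|X|](subrK (M (f z - f a - L (z - a)))).
  rewrite (le_trans (ler_normD _ _))//.
  have -> : g (f z) - g (f a) - M (L (z - a)) - M (f z - f a - L (z - a)) =
            g (f z) - g (f a) - M (f z - f a).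
    by rewrite -addrA -opprD -linearDf// addrC addrC [L _ + _]addrC subrK.
  have -> : e = e1 * C + D * e1 by rewrite (mulrC D) -mulrDr /e1 divfK// gt_eqF// addr_gt0.
  rewrite mulrDl lerD//.
    by rewrite (le_trans gz)// -mulrA ler_wpM2l// ltW.
  by rewrite (le_trans (hD _))// -mulrA ler_wpM2l// ltW.
Unshelve. all: by end_near. Qed.

Section Scalar.
Variables (V : normedModType R) (A : set V).
Implicit Types (f g : V -> R) (a : V) (L M : V -> R).

Lemma der_onM f g a L M : der_on A f a L -> der_on A g a M ->
  der_on A (fun z => f z * g z) a (fun x => L x * g a + f a * M x).
Proof.
move=> fL gM.
have [C C0 fC] := der_on_lipschitz fL.
have gc := der_on_cvg gM.
case: fL gM => lL [CL hCL] fL [lM [D hD] gM]; split.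
- by move=> k x y; rewrite lL lM; rewrite /GRing.scale/=; ring.
- exists (CL * `|g a| + `|f a| * D) => x; rewrite (le_trans (ler_normD _ _))//.
  rewrite !normrM mulrDl lerD//; first by rewrite mulrAC ler_wpM2r.
  by rewrite -mulrA ler_wpM2l.
- move=> e e0.
  (* The summands match [f a] times the error of [g], the error of [f] times [g a], and the product
     of the two increments. *)
  pose e1 := e / (`|f a| + `|g a| + C).
  have S0 : 0 < `|f a| + `|g a| + C by rewrite ltr_wpDl// addr_ge0.
  have e10 : 0 < e1 by rewrite divr_gt0.
  near=> z => Az.
  have fCz : `|f z - f a| <= C * `|z - a| by move: Az; near: z.
  have gcz : `|g z - g a| < e1 by move: Az; near: z; exact: gc.
  have fz : `|f z - f a - L (z - a)| <= e1 * `|z - a|.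
    by move: Az; near: z; exact: fL.
  have gz : `|g z - g a - M (z - a)| <= e1 * `|z - a|.
    by move: Az; near: z; exact: gM.
  rewrite [X in `|X|](_ : _ = f a * (g z - g a - M (z - a)) +
     (f z - f a - L (z - a)) * g a + (f z - f a) * (g z - g a)); last by ring.
  rewrite (le_trans (ler_normD _ _))//.
  rewrite (_ : e = `|f a| * e1 + e1 * `|g a| + C * e1); last first.
    by rewrite /e1; field; rewrite gt_eqF.
  rewrite [leRHS]mulrDl lerD//.
    rewrite (le_trans (ler_normD _ _))// [leRHS]mulrDl lerD// normrM.
      by rewrite -mulrA ler_wpM2l.
    by rewrite mulrAC ler_wpM2r.
  rewrite normrM [leRHS]mulrAC ler_pM//.
  exact: ltW.
Unshelve. all: by end_near. Qed.

End Scalar.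

End DerOn.

(** * Derivatives of matrix-valued maps and of curves *)

Section MatrixDerivatives.
Context {R : realType}.

Section Entries.
Variables (V : normedModType R) (A : set V).

Lemma ler_entry_norm (p q : nat) (M : 'M[R]_(p, q)) i j : `|M i j| <= `|M|.
Proof.
rewrite [leRHS]/Num.Def.normr/= mx_normrE.
exact: (le_bigmax _ (fun ij => `|M ij.1 ij.2|) (i, j)).
Qed.

Lemma der_on_entry (p q : nat) (M DM : V -> 'M[R]_(p, q)) a i j :
  der_on A M a DM -> der_on A (fun z => M z i j) a (fun x => DM x i j).
Proof.
move=> MD.
apply: (@der_on_comp R V 'M[R]_(p, q) R A setT M (fun M => M i j) a DM
  (fun M => M i j)) => //.
  apply: linear_bound_der_on; first by move=> k x y; rewrite !mxE.
  by exists 1 => x; rewrite mul1r ler_entry_norm.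
by near=> z.
Unshelve. all: by end_near. Qed.

(** Expanding a matrix in the basis [delta_mx i j] leaves only sums and linear maps of a scalar, so
    the matrix norm need not be opened. *)
Lemma der_on_mx (p q : nat) (M DM : V -> 'M[R]_(p, q)) a :
  (forall i j, der_on A (fun z => M z i j) a (fun x => DM x i j)) ->
  der_on A M a DM.
Proof.
move=> MD.
have E (N : V -> 'M[R]_(p, q)) :
    N = fun z => \sum_i \sum_j N z i j *: delta_mx i j.
  by apply/funext => z; rewrite {1}(matrix_sum_delta (N z)).
rewrite (E M) (E DM); apply: der_on_sum => i; apply: der_on_sum => j.
apply: (@der_on_comp R V R 'M[R]_(p, q) A setT (fun z => M z i j)
  (fun r => r *: delta_mx i j) a (fun z => DM z i j) (fun r => r *: delta_mx i j)) => //.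
  apply: linear_bound_der_on; first by move=> k x y; rewrite scalerDl scalerA.
  by exists `|delta_mx i j : 'M[R]_(p, q)| => x; rewrite normrZ mulrC.
by near=> z.
Unshelve. all: by end_near. Qed.

Lemma der_on_mulmx (p q r : nat) (M DM : V -> 'M[R]_(p, q))
    (N DN : V -> 'M[R]_(q, r)) a :
  der_on A M a DM -> der_on A N a DN ->
  der_on A (fun z => M z *m N z) a (fun x => DM x *m N a + M a *m DN x).
Proof.
move=> MD ND; apply: der_on_mx => i j.
rewrite (_ : (fun z => _) = fun z => \sum_k M z i k * N z k j); last first.
  by apply/funext => z; rewrite mxE.
apply: eq_der_on (der_on_sum _ (fun k => der_onM (der_on_entry i k MD)
  (der_on_entry k j ND))) => x.
by rewrite !mxE -big_split.
Qed.

Lemma der_on_tr (p q : nat) (M DM : V -> 'M[R]_(p, q)) a :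
  der_on A M a DM -> der_on A (fun z => (M z)^T) a (fun x => (DM x)^T).
Proof.
move=> MD; apply: der_on_mx => i j.
rewrite (_ : (fun z => _) = fun z => M z j i); last first.
  by apply/funext => z; rewrite mxE.
by apply: eq_der_on (der_on_entry j i MD) => x; rewrite mxE.
Qed.

Lemma der_on_scalemx (p q : nat) (u L : V -> R) (M DM : V -> 'M[R]_(p, q)) a :
  der_on A u a L -> der_on A M a DM ->
  der_on A (fun z => u z *: M z) a (fun x => L x *: M a + u a *: DM x).
Proof.
move=> uL MD; apply: der_on_mx => i j.
rewrite (_ : (fun z => _) = fun z => u z * M z i j); last first.
  by apply/funext => z; rewrite mxE.
by apply: eq_der_on (der_onM uL (der_on_entry i j MD)) => x; rewrite !mxE.
Qed.

Lemma der_on_row_mx (p q r : nat) (M DM : V -> 'M[R]_(p, q))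
    (P DP : V -> 'M[R]_(p, r)) a :
  der_on A M a DM -> der_on A P a DP ->
  der_on A (fun z => row_mx (M z) (P z)) a (fun x => row_mx (DM x) (DP x)).
Proof.
move=> MD PD; apply: der_on_mx => i j; case: (split_ordP j) => k ->.
  rewrite (_ : (fun z => _) = fun z => M z i k); last first.
    by apply/funext => z; rewrite row_mxEl.
  by apply: eq_der_on (der_on_entry i k MD) => x; rewrite row_mxEl.
rewrite (_ : (fun z => _) = fun z => P z i k); last first.
  by apply/funext => z; rewrite row_mxEr.
by apply: eq_der_on (der_on_entry i k PD) => x; rewrite row_mxEr.
Qed.

Lemma der_on_col_mx (p q r : nat) (M DM : V -> 'M[R]_(p, r))
    (P DP : V -> 'M[R]_(q, r)) a :
  der_on A M a DM -> der_on A P a DP ->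
  der_on A (fun z => col_mx (M z) (P z)) a (fun x => col_mx (DM x) (DP x)).
Proof.
move=> /der_on_tr MD /der_on_tr PD.
rewrite (_ : (fun z => _) = fun z => (row_mx (M z)^T (P z)^T)^T); last first.
  by apply/funext => z; rewrite tr_row_mx !trmxK.
apply: eq_der_on (der_on_tr (der_on_row_mx MD PD)) => x.
by rewrite tr_row_mx !trmxK.
Qed.

Lemma der_on_block_mx (p q r s : nat) (M1 D1 : V -> 'M[R]_(p, r))
    (M2 D2 : V -> 'M[R]_(p, s)) (M3 D3 : V -> 'M[R]_(q, r))
    (M4 D4 : V -> 'M[R]_(q, s)) a :
  der_on A M1 a D1 -> der_on A M2 a D2 -> der_on A M3 a D3 -> der_on A M4 a D4 ->
  der_on A (fun z => block_mx (M1 z) (M2 z) (M3 z) (M4 z)) a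
    (fun x => block_mx (D1 x) (D2 x) (D3 x) (D4 x)).
Proof.
by move=> d1 d2 d3 d4; exact (der_on_col_mx (der_on_row_mx d1 d2) (der_on_row_mx d3 d4)).
Qed.

End Entries.

Section Curves.
Variables (W : normedModType R) (A : set R).

Lemma has_deriv_withinP (c : R -> W) s w :
  has_deriv_within A c s w <-> der_on A c s (fun h => h *: w).
Proof.
rewrite /has_deriv_within; split=> [cw|[_ _ cw]].
  split.
  - by move=> k x y; rewrite scalerDl scalerA.
  - by exists `|w| => x; rewrite normrZ mulrC.
  move=> e e0; move/cvgrPdist_le: cw => /(_ _ e0).
  rewrite near_withinE /dnbhs near_withinE => h.
  near=> u => Au.
  (* The difference quotient only sees [u != s]; at [s] itself both sides of the estimate vanish. *)
  have [->|us] := eqVneq u s; first by rewrite !subrr scale0r subrr !normr0 mulr0.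
  have us0 : u - s != 0 by rewrite subr_eq0.
  have /(_ us Au) : u != s -> A u ->
    `|w - (u - s)^-1 *: (c u - c s)| <= e by near: u.
  rewrite -(@ler_pM2l _ `|u - s|) ?normr_gt0// -normrZ scalerBr scalerA.
  by rewrite divff// scale1r distrC mulrC.
apply/cvgrPdist_le => e e0; rewrite near_withinE /dnbhs near_withinE.
have := cw _ e0; apply: filterS => u h us Au.
have us0 : u - s != 0 by rewrite subr_eq0.
rewrite -(@ler_pM2l _ `|u - s|) ?normr_gt0// -normrZ scalerBr scalerA.
rewrite divff// scale1r distrC mulrC; exact: h.
Unshelve. all: by end_near. Qed.

End Curves.
End MatrixDerivatives.

(** * One-sided directional derivatives *)

Section Directions.
Context {R : realType}.

Lemma near_ray (V : normedModType R) (a d : V) (P : V -> Prop) :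
  (\forall z \near a, P z) -> \forall t \near (0 : R)^'+, P (a + t *: d).
Proof.
move=> /nbhs_normP[r /= r0 hr].
have d0 : 0 < `|d| + 1 by rewrite ltr_wpDl.
near=> t; have t0 : 0 < t by near: t; exact: nbhs_right_gt.
apply: hr; rewrite /ball_/= opprD addNKr normrN normrZ gtr0_norm//.
apply: le_lt_trans (_ : t * (`|d| + 1) < r).
  by rewrite ler_wpM2l ?(ltW t0)// lerDl.
by rewrite -ltr_pdivlMr//; near: t; apply: nbhs_right_lt; rewrite divr_gt0.
Unshelve. all: by end_near. Qed.

(** The limit has the shape of [partial]: increments come from the right, so only the ray leaving
    [a] along [d] has to stay in [A]. *)
Lemma der_on_dir (V W : normedModType R) (A : set V) (u : V -> W) a L d :
  der_on A u a L -> (\forall t \near (0 : R)^'+, A (a + t *: d)) ->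
  (fun t : R => t^-1 *: (u (a + t *: d) - u a)) @ 0^'+ --> L d.
Proof.
move=> [lL _ uL] Ad; apply/cvgrPdist_le => e e0.
have d0 : 0 < `|d| + 1 by rewrite ltr_wpDl.
near=> t.
have t0 : 0 < t by near: t; exact: nbhs_right_gt.
have h : `|u (a + t *: d) - u a - L (t *: d)| <= e / (`|d| + 1) * (t * `|d|).
  have /(_ _) : A (a + t *: d) -> `|u (a + t *: d) - u a - L (a + t *: d - a)|
      <= e / (`|d| + 1) * `|a + t *: d - a|.
    near: t; apply: (@near_ray _ a d (fun z => A z ->
      `|u z - u a - L (z - a)| <= e / (`|d| + 1) * `|z - a|)).
    by apply: uL; rewrite divr_gt0.
  rewrite [a + _ - a]addrAC subrr add0r normrZ gtr0_norm//; apply.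
  by near: t.
rewrite -(@ler_pM2l _ `|t|) ?gtr0_norm// -{1}(gtr0_norm t0) -normrZ scalerBr scalerA.
rewrite divff ?gt_eqF// scale1r distrC -(linearZf lL).
rewrite (le_trans h)// mulrCA ler_wpM2l ?(ltW t0)// -mulrA ler_piMr ?(ltW e0)//.
by rewrite ler_pdivrMl// mulr1 lerDl.
Unshelve. all: by end_near. Qed.

Lemma der_on_dir_eq (V W : normedModType R) (A : set V) (u : V -> W) a L d w :
  der_on A u a L ->
  (\forall t \near (0 : R)^'+, A (a + t *: d) /\ u (a + t *: d) - u a = t *: w) ->
  L d = w.
Proof.
move=> uL Aw.
have Ad : \forall t \near (0 : R)^'+, A (a + t *: d) by apply: filterS Aw => t [].
have /cvg_lim <- // := der_on_dir uL Ad.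
apply/cvg_lim => //; apply: cvg_near_cst; near=> t.
have [_ ->] : A (a + t *: d) /\ u (a + t *: d) - u a = t *: w by near: t.
have t0 : 0 < t by near: t; exact: nbhs_right_gt.
by rewrite scalerA mulVf ?scale1r// gt_eqF.
Unshelve. all: by end_near. Qed.

Lemma der_on_dir_ge0 (V : normedModType R) (A : set V) (u : V -> R) a L d :
  der_on A u a L -> u a = 0 ->
  (\forall t \near (0 : R)^'+, A (a + t *: d) /\ 0 <= u (a + t *: d)) ->
  0 <= L d.
Proof.
move=> uL ua Aw.
have Ad : \forall t \near (0 : R)^'+, A (a + t *: d) by apply: filterS Aw => t [].
have /cvgP cv := der_on_dir uL Ad.
have /cvg_lim <- // := der_on_dir uL Ad.
apply: limr_ge => //; near=> t.
have [_ h] : A (a + t *: d) /\ 0 <= u (a + t *: d) by near: t.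
have t0 : 0 < t by near: t; exact: nbhs_right_gt.
by rewrite ua subr0 mulr_ge0// invr_ge0 ltW.
Unshelve. all: by end_near. Qed.

End Directions.

Section Halfspace.
Context {R : realType} {n : nat}.
Local Notation E := 'rV[R]_n.+1.
Local Notation H := (@halfspace R n).

Lemma halfspace_add (a : E) k (t : R) : H a -> 0 <= t -> H (a + t *: delta_mx 0 k).
Proof.
rewrite /halfspace/= => a0 t0; rewrite !mxE addr_ge0// mulr_ge0//.
Qed.

(** Rays along increasing coordinates never leave the half-space. A derivative relative to it is
    thus determined on the basis, even at a boundary point. *)
Lemma der_on_partial (W : normedModType R) (u : E -> W) a L k :
  H a -> der_on H u a L -> partial k u a = L (delta_mx 0 k).
Proof.
move=> Ha uL; apply/cvg_lim => //; apply: (der_on_dir uL).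
near=> t; have t0 : 0 < t by near: t; exact: nbhs_right_gt.
exact: halfspace_add Ha (ltW t0).
Unshelve. all: by end_near. Qed.

Lemma der_onE (W : normedModType R) (u : E -> W) a L : H a -> der_on H u a L ->
  forall x, L x = \sum_k x 0 k *: partial k u a.
Proof.
move=> Ha uL x; have [lL _ _] := uL.
rewrite {1}(row_sum_delta x) linear_sumf//; apply: eq_bigr => k _.
by rewrite linearZf// (der_on_partial k Ha uL).
Qed.

End Halfspace.

(** * Symmetry of second derivatives *)

Section Schwarz.
Context {R : realType}.

Lemma der_on_sub (V W : normedModType R) (A B : set V) (f : V -> W) a L :
  A `<=` B -> der_on B f a L -> der_on A f a L.
Proof.
move=> AB [lL bL fL]; split=> // e e0.
by have := fL _ e0; apply: filterS => z h /AB.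
Qed.

Lemma differentiable_der_on (V W : normedModType R) (f : V -> W) a :
  differentiable f a -> der_on setT f a ('d f a).
Proof.
move=> df; split; first by move=> k x y; rewrite linearP.
  have [k _ hk] := linear_lipschitz (diff_continuous df).
  by exists k.
move=> e e0; have /eqaddoP/(_ _ e0) := diff_locally df.
move=> /nbhs_normP[r /= r0 hr].
apply/nbhs_normP; exists r => //= z /=; rewrite /ball_/= => zr _.
have := hr (z - a); rewrite /ball_ /= sub0r opprB => /(_ zr).
by rewrite /= !fctE /= subrK opprD addrA.
Qed.

Lemma der_on_is_derive (V W : normedModType R) (f : V -> W) a L v :
  der_on setT f a L -> is_derive a v f (L v).
Proof.
move=> [lL bL fL].
suff h : (fun t : R => t^-1 *: ((f \o shift a) (t *: v) - f a)) @ 0^' --> L v.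
  by split; [apply/cvg_ex; exists (L v)|apply/cvg_lim].
apply/cvgrPdist_le => e e0.
have v0 : 0 < `|v| + 1 by rewrite ltr_wpDl.
have /nbhs_normP[r /= r0 hr] := fL _ (divr_gt0 e0 v0).
near=> t.
have t0 : t != 0 by near: t; exact: nbhs_dnbhs_neq.
have tr : `|t| < r / (`|v| + 1) by near: t; apply: dnbhs0_lt; rewrite divr_gt0.
have h : `|f (t *: v + a) - f a - L (t *: v)| <= e / (`|v| + 1) * (`|t| * `|v|).
  have := hr (t *: v + a); rewrite /ball_/= opprD addrCA subrr addr0 normrN normrZ.
  rewrite addrK normrZ; apply=> //.
  apply: le_lt_trans (_ : `|t| * (`|v| + 1) < r); first by rewrite ler_wpM2l// lerDl.
  by rewrite -ltr_pdivlMr.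
rewrite -(@ler_pM2l _ `|t|) ?normr_gt0// -normrZ scalerBr scalerA divff// scale1r.
rewrite distrC -(linearZf lL) (le_trans h)// mulrCA ler_wpM2l//.
rewrite -mulrA ler_piMr ?(ltW e0)//.
by rewrite ler_pdivrMl// mulr1 lerDl.
Unshelve. all: by end_near. Qed.

Lemma is_derive_line (V W : normedModType R) (g : V -> W) (b v : V) (s : R) :
  derivable g (b + s *: v) v ->
  is_derive s 1 (fun s : R => g (b + s *: v)) ('D_v g (b + s *: v)).
Proof.
have E : (fun h : R => h^-1 *: (((fun s : R => g (b + s *: v)) \o shift s) (h *: 1)
    - g (b + s *: v))) =
  (fun h : R => h^-1 *: ((g \o shift (b + s *: v)) (h *: v) - g (b + s *: v))).
  apply/funext => h /=; congr (_ *: (g _ - _)).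
  by rewrite [h *: 1]mulr1 scalerDl addrCA.
by move=> dg; split; rewrite /derivable /derive E.
Qed.

Section Symmetry.
Variables (V : normedModType R) (g : V -> R) (a : V).
Hypothesis dg : \forall z \near a, exists L, der_on setT g z L.

(* Mean value theorem for [s |-> g (a + t w + s v) - g (a + s v)] on [[0, t]]. *)
Let second_difference_bound (v w : V) L : der_on setT ('D_v g) a L ->
  forall e, 0 < e -> \forall t \near 0^'+,
    `|g (a + t *: v + t *: w) - g (a + t *: v) - (g (a + t *: w) - g a)
      - t ^+ 2 * L w| <= e * t ^+ 2.
Proof.
move=> [lL bL gL] e e0.
(* The expansion of ['D_v g] is used at the displacements [c v + t w] and [c v] with [c <= t], whose
   norms add up to at most [t] times [2 |v| + |w|]; the [1] guards against zero vectors. *)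
have c0 : 0 < 2 * `|v| + `|w| + 1 by rewrite ltr_wpDl// addr_ge0// mulr_ge0.
have d0 : 0 < `|v| + `|w| + 1 by rewrite ltr_wpDl// addr_ge0.
have /nbhs_normP[r /= r0 hr] := gL _ (divr_gt0 e0 c0).
have /nbhs_normP[r' /= r'0 hr'] := dg.
near=> t.
have t0 : 0 < t by near: t; exact: nbhs_right_gt.
have tr : t * (`|v| + `|w|) < r.
  apply: le_lt_trans (_ : t * (`|v| + `|w| + 1) < r).
    by rewrite ler_wpM2l ?(ltW t0)// lerDl.
  by rewrite -ltr_pdivlMr//; near: t; apply: nbhs_right_lt; rewrite divr_gt0.
have tr' : t * (`|v| + `|w|) < r'.
  apply: le_lt_trans (_ : t * (`|v| + `|w| + 1) < r').
    by rewrite ler_wpM2l ?(ltW t0)// lerDl.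
  by rewrite -ltr_pdivlMr//; near: t; apply: nbhs_right_lt; rewrite divr_gt0.
have nv s : 0 <= s <= t -> `|s *: v| <= t * `|v|.
  by move=> /andP[s0 st]; rewrite normrZ ger0_norm// ler_wpM2r.
have nw : `|t *: w| = t * `|w| by rewrite normrZ gtr0_norm.
have nvw s : 0 <= s <= t -> `|s *: v + t *: w| <= t * (`|v| + `|w|).
  by move=> /nv h; rewrite (le_trans (ler_normD _ _))// mulrDr nw lerD2r.
have nv' s : 0 <= s <= t -> `|s *: v| <= t * (`|v| + `|w|).
  by move=> /nv h; rewrite (le_trans h)// ler_wpM2l ?(ltW t0)// lerDl.
pose P (s : R) := g (a + t *: w + s *: v) - g (a + s *: v).
have dP s : 0 <= s <= t ->
    is_derive s 1 P ('D_v g (a + t *: w + s *: v) - 'D_v g (a + s *: v)).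
  move=> st.
  have h1 : derivable g (a + t *: w + s *: v) v.
    have [|M /(der_on_is_derive v)[]//] := hr' (a + t *: w + s *: v).
    rewrite /ball_/= -addrA opprD addNKr normrN addrC.
    by rewrite (le_lt_trans (nvw _ st)).
  have h2 : derivable g (a + s *: v) v.
    have [|M /(der_on_is_derive v)[]//] := hr' (a + s *: v).
    by rewrite /ball_/= opprD addNKr normrN (le_lt_trans (nv' _ st)).
  by apply: is_deriveB; exact: is_derive_line.
have [|||c c0t] := @MVT R P (fun s => 'D_v g (a + t *: w + s *: v) - 'D_v g (a + s *: v)) 0 t => //.
  by move=> s; rewrite in_itv/= => /andP[s0 st]; apply: dP; rewrite !ltW.
  apply: derivable_within_continuous => s; rewrite in_itv/= => st.
  by case: (dP s st).
have {c0t}ct : 0 <= c <= t by move: c0t; rewrite in_itv/= => /andP[? ?]; rewrite !ltW.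
rewrite {1 2}/P !scale0r !addr0 subr0 (addrAC a) => ->.
have h1 : `|'D_v g (a + t *: w + c *: v) - 'D_v g a - L (c *: v + t *: w)| <=
    e / (2 * `|v| + `|w| + 1) * (t * (`|v| + `|w|)).
  have := hr (a + t *: w + c *: v); rewrite /ball_/= -addrA opprD addNKr normrN addrC.
  rewrite [a + _ - a]addrAC subrr add0r [c *: v + _]addrC => h.
  rewrite (le_trans (h _ _))//; first by rewrite addrC (le_lt_trans (nvw _ ct)).
  by rewrite ler_wpM2l ?divr_ge0 ?(ltW e0) ?(ltW c0)// addrC nvw.
have h2 : `|'D_v g (a + c *: v) - 'D_v g a - L (c *: v)| <=
    e / (2 * `|v| + `|w| + 1) * (t * `|v|).
  have := hr (a + c *: v); rewrite /ball_/= opprD addNKr normrN.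
  rewrite [a + _ - a]addrAC subrr add0r => h.
  rewrite (le_trans (h _ _))//; first by rewrite (le_lt_trans (nv' _ ct)).
  by rewrite ler_wpM2l ?divr_ge0 ?(ltW e0) ?(ltW c0)// nv.
move: h1; rewrite (linearDf lL) (linearZf lL t) => h1.
set X1 := 'D_v g (a + t *: w + c *: v) in h1 *.
set X2 := 'D_v g (a + c *: v) in h2 *.
rewrite [X in `|X|](_ : _ = t * ((X1 - 'D_v g a - (L (c *: v) + t *: L w))
   - (X2 - 'D_v g a - L (c *: v)))); last by rewrite /GRing.scale/=; ring.
rewrite normrM gtr0_norm// [t ^+ 2]expr2 mulrCA ler_wpM2l ?(ltW t0)//.
rewrite (le_trans (ler_normB _ _))// (le_trans (lerD h1 h2))//.
rewrite -mulrDr -mulrDr mulrCA [e * t]mulrC ler_wpM2l ?(ltW t0)//.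
rewrite -mulrA ler_piMr ?(ltW e0)// ler_pdivrMl// mulr1 addrAC.
by rewrite mulr2n mulrDl mul1r lerDl.
Unshelve. all: by end_near. Qed.

(** The second difference is symmetric in [v] and [w]; divided by [t ^+ 2] it is close to [L w] and
    to [M v] at once. *)
Lemma derive_sym (v w : V) L M : der_on setT ('D_v g) a L ->
  der_on setT ('D_w g) a M -> 'D_w ('D_v g) a = 'D_v ('D_w g) a.
Proof.
move=> gL gM.
have -> : 'D_w ('D_v g) a = L w by have [_ ->] := der_on_is_derive w gL.
have -> : 'D_v ('D_w g) a = M v by have [_ ->] := der_on_is_derive v gM.
apply/eqP; rewrite -subr_eq0 -normr_le0; apply/ler_addgt0Pr => e e0.
rewrite add0r.
have e20 : 0 < e / 2 by rewrite divr_gt0.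
near (0 : R)^'+ => t.
have t0 : 0 < t by near: t; exact: nbhs_right_gt.
have h1 : `|g (a + t *: v + t *: w) - g (a + t *: v) - (g (a + t *: w) - g a)
    - t ^+ 2 * L w| <= e / 2 * t ^+ 2 by near: t; exact: second_difference_bound.
have h2 : `|g (a + t *: w + t *: v) - g (a + t *: w) - (g (a + t *: v) - g a)
    - t ^+ 2 * M v| <= e / 2 * t ^+ 2 by near: t; exact: second_difference_bound.
rewrite [a + _ + _]addrAC in h2.
have t20 : 0 < t ^+ 2 by rewrite exprn_gt0.
rewrite -(ler_pM2l t20) -{1}(gtr0_norm t20) -normrM.
rewrite (_ : t ^+ 2 * e = e / 2 * t ^+ 2 + e / 2 * t ^+ 2); last by field.
apply: le_trans (lerD h2 h1); apply: le_trans (ler_normB _ _).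
by rewrite le_eqVlt; apply/orP; left; apply/eqP; congr `| _ |; ring.
Unshelve. all: by end_near. Qed.

End Symmetry.
End Schwarz.

(** * Twice differentiable functions on the half-space *)

(* Otherwise failing unification attempts unfold the limits. *)
#[local] Opaque partial.

Section HalfspaceCalculus.
Context {R : realType} {n : nat}.
Local Notation E := 'rV[R]_n.+1.
Local Notation H := (@halfspace R n).
Implicit Types (u v : E -> R) (a : E).

Definition grad u a : 'cV[R]_n.+1 := \col_k partial k u a.

Definition has_grad u a := der_on H u a (fun x => (x *m grad u a) 0 0).

Definition has_jac (p : nat) (f : E -> 'rV[R]_p) a :=
  der_on H f a (fun x => x *m jac f a).

(* The symmetry of the second partial derivatives is part of the definition:
   on the half-space it is obtained from Schwarz's theorem for a smooth
   extension, and it is preserved by composition. *)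
Definition c2_at u a :=
  [/\ \forall z \near a, H z -> has_grad u z,
      forall k, has_grad (partial k u) a
    & forall k l, partial k (partial l u) a = partial l (partial k u) a].

Lemma der_on_has_grad u a L : H a -> der_on H u a L -> has_grad u a.
Proof.
move=> Ha uL; apply: eq_der_on (uL) => x.
by rewrite (der_onE Ha uL) mxE; apply: eq_bigr => k _; rewrite mxE.
Qed.

Lemma der_on_grad u a (g : 'cV[R]_n.+1) : H a ->
  der_on H u a (fun x => (x *m g) 0 0) -> grad u a = g.
Proof.
move=> Ha uL; apply/colP => k; rewrite mxE (der_on_partial k Ha uL).
by rewrite -rowE mxE.
Qed.

Lemma der_on_jac (p : nat) (f : E -> 'rV[R]_p) a (J : 'M[R]_(n.+1, p)) : H a ->
  der_on H f a (fun x => x *m J) -> jac f a = J.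
Proof.
move=> Ha fJ; apply/matrixP => k l; rewrite mxE.
by rewrite (der_on_partial k Ha (der_on_entry 0 l fJ)) -rowE mxE.
Qed.

Lemma has_jac_entries (p : nat) (f : E -> 'rV[R]_p) a :
  (forall l, has_grad (fun z => f z 0 l) a) -> has_jac f a.
Proof.
move=> fl; apply: der_on_mx => i l; rewrite ord1.
by apply: eq_der_on (fl l) => x; rewrite !mxE; apply: eq_bigr => k _; rewrite !mxE.
Qed.

Lemma der_on_mx_grad (p q : nat) (M : E -> 'M[R]_(p, q)) a :
  (forall k l, has_grad (fun z => M z k l) a) ->
  der_on H M a (fun x => \matrix_(k, l) (x *m grad (fun z => M z k l) a) 0 0).
Proof.
by move=> dM; apply: der_on_mx => k l; apply: eq_der_on (dM k l) => x; rewrite [RHS]mxE.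
Qed.

Lemma grad_near u v a : H a -> (\forall z \near a, H z -> u z = v z) ->
  has_grad u a -> grad v a = grad u a.
Proof.
by move=> Ha uv ua; apply: (der_on_grad Ha); apply: (der_on_near Ha uv); exact: ua.
Qed.

Lemma has_grad_near u v a : H a -> (\forall z \near a, H z -> u z = v z) ->
  has_grad u a -> has_grad v a.
Proof.
move=> Ha uv ua; apply: der_on_has_grad => //.
by apply: der_on_near uv _ => //; exact: ua.
Qed.

Lemma jac_near (p : nat) (f g : E -> 'rV[R]_p) a : H a ->
  (\forall z \near a, H z -> f z = g z) -> has_jac f a -> jac g a = jac f a.
Proof.
by move=> Ha uv ua; apply: (der_on_jac Ha); apply: (der_on_near Ha uv); exact: ua.
Qed.

Lemma partial_near u v a k : H a -> (\forall z \near a, H z -> u z = v z) ->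
  has_grad u a -> partial k v a = partial k u a.
Proof. by move=> Ha uv /(grad_near Ha uv)/colP/(_ k); rewrite !mxE. Qed.

Lemma c2_near u v a : H a -> (\forall z \near a, H z -> u z = v z) ->
  c2_at u a -> c2_at v a.
Proof.
move=> Ha uv [du d2u sym].
(* [partial] is itself a limit, so comparing it at points near [a] takes agreement of [u] and [v]
   around each of these points. *)
have uv2 : \forall z \near a, \forall y \near z, H y -> u y = v y.
  exact: nbhs_interior.
have puv k : \forall z \near a, H z -> partial k u z = partial k v z.
  near=> z => Hz; apply/esym/partial_near => //; first by near: z.
  by move: Hz; near: z.
have pp k l : partial k (partial l v) a = partial k (partial l u) a.
  exact: partial_near.
split.
- near=> z => Hz; apply: has_grad_near (_ : has_grad u z) => //; first by near: z.
  by move: Hz; near: z.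
- by move=> k; apply: has_grad_near (d2u k).
- move=> k l; exact (etrans (pp k l) (etrans (sym k l) (esym (pp l k)))).
Unshelve. all: by end_near. Qed.

Lemma c2_has_grad u a : H a -> c2_at u a -> has_grad u a.
Proof. by move=> Ha [/nbhs_singleton du _ _]; exact: du. Qed.

Lemma has_grad_comp (psi : E -> E) u a : H a -> has_jac psi a ->
  has_grad u (psi a) -> (\forall z \near a, H z -> H (psi z)) ->
  has_grad (u \o psi) a /\ grad (u \o psi) a = jac psi a *m grad u (psi a).
Proof.
move=> Ha dpsi du HH.
have d := der_on_comp dpsi du HH.
split; first exact: der_on_has_grad d.
by apply: (der_on_grad Ha); apply: eq_der_on d => x /=; rewrite mulmxA.
Qed.

Lemma has_jac_comp (p : nat) (psi : E -> E) (f : E -> 'rV[R]_p) a : H a ->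
  has_jac psi a -> has_jac f (psi a) -> (\forall z \near a, H z -> H (psi z)) ->
  has_jac (f \o psi) a /\ jac (f \o psi) a = jac psi a *m jac f (psi a).
Proof.
move=> Ha dpsi df HH.
have d := der_on_comp dpsi df HH.
have e : jac (f \o psi) a = jac psi a *m jac f (psi a).
  by apply: (der_on_jac Ha); apply: eq_der_on d => x /=; rewrite mulmxA.
split; last exact: e.
by rewrite /has_jac e; apply: eq_der_on d => x /=; rewrite mulmxA.
Qed.

(** The second partials of the composite are the two sums in [pp]. The first is symmetric because
    each component of [psi] has symmetric second partials, the second, after exchanging the sums,
    because [u] does. *)
Lemma c2_comp (psi : E -> E) u a : H a ->
  (forall l, c2_at (fun z => psi z 0 l) a) -> c2_at u (psi a) ->
  (\forall z \near a, H z -> H (psi z)) -> c2_at (u \o psi) a.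
Proof.
move=> Ha psi2 u2 HH.
have jpsi : \forall z \near a, H z -> has_jac psi z.
  have h : \forall z \near a, forall l, H z -> has_grad (fun z => psi z 0 l) z.
    apply: (@filter_forall _ _ (fun l z => H z -> has_grad (fun z => psi z 0 l) z)
      (nbhs a) _) => l.
    by case: (psi2 l).
  by apply: filterS h => z h Hz; apply: has_jac_entries => l; exact: h.
have ja : has_jac psi a by exact: (nbhs_singleton jpsi).
have Hpa : H (psi a) by exact: (nbhs_singleton HH).
have HH2 : \forall z \near a, \forall y \near z, H y -> H (psi y).
  exact: nbhs_interior.
have du : \forall z \near a, H z -> has_grad u (psi z).
  case: u2 => /nbhs_normP[r /= r0 hr] _ _.
  near=> z => Hz; apply: hr.
    rewrite /ball_/= distrC; move: Hz; near: z.
    exact: der_on_cvg ja _ r0.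
  by move: Hz; near: z.
have chain : \forall z \near a, H z -> has_grad (u \o psi) z /\
    grad (u \o psi) z = jac psi z *m grad u (psi z).
  near=> z => Hz; apply: (has_grad_comp Hz).
  - by move: Hz; near: z; exact: jpsi.
  - by move: Hz; near: z; exact: du.
  - by near: z; exact: HH2.
(* The derivative, by the product rule, of the chain rule formula for [partial k (u \o psi)]. *)
pose D k (x : E) : R := \sum_l ((x *m grad (partial k (fun z => psi z 0 l)) a) 0 0 *
    partial l u (psi a) +
  partial k (fun z => psi z 0 l) a *
    (x *m (jac psi a *m grad (partial l u) (psi a))) 0 0).
have dp k : der_on H (partial k (u \o psi)) a (D k).
  apply: (@der_on_near _ _ _ _
    (fun z => \sum_l partial k (fun z => psi z 0 l) z * partial l u (psi z))) => //.
    near=> z => Hz.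
    have [_ /colP/(_ k)] : has_grad (u \o psi) z /\
      grad (u \o psi) z = jac psi z *m grad u (psi z) by move: Hz; near: z.
    by rewrite !mxE => ->; apply: eq_bigr => l _; rewrite !mxE.
  apply: der_on_sum => l; apply: der_onM.
    by case: (psi2 l) => _ /(_ k).
  have [h1 h2] : has_grad (partial l u \o psi) a /\
    grad (partial l u \o psi) a = jac psi a *m grad (partial l u) (psi a).
    by apply: has_grad_comp => //; case: u2 => _ /(_ l).
  by rewrite -h2.
have pp m k : partial m (partial k (u \o psi)) a =
    \sum_l (partial m (partial k (fun z => psi z 0 l)) a * partial l u (psi a)) +
    \sum_l \sum_r partial k (fun z => psi z 0 l) a * partial m (fun z => psi z 0 r) a *
      partial r (partial l u) (psi a).
  rewrite (der_on_partial m Ha (dp k)) /D big_split/=; congr (_ + _).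
    by apply: eq_bigr => l _; rewrite -rowE !mxE.
  apply: eq_bigr => l _; rewrite mulmxA -rowE !mxE mulr_sumr.
  by apply: eq_bigr => r _; rewrite !mxE mulrA.
split.
- by apply: filterS chain => z h /h[].
- by move=> k; apply: der_on_has_grad (dp k).
- move=> m k.
  refine (etrans (pp m k) (etrans (f_equal2 +%R _ _) (esym (pp k m)))).
    apply: eq_bigr => l _; refine (f_equal2 *%R _ (erefl _)).
    by case: (psi2 l) => _ _; exact.
  rewrite exchange_big/=; apply: eq_bigr => r _; apply: eq_bigr => l _.
  refine (f_equal2 *%R (mulrC _ _) _).
  by case: u2 => _ _; exact.
Unshelve. all: by end_near. Qed.

Lemma c2N u a : H a -> c2_at u a -> c2_at (fun z => - u z) a.
Proof.
move=> Ha [du d2u sym].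
have pN k z : H z -> has_grad u z -> partial k (fun z => - u z) z = - partial k u z.
  by move=> Hz uz; rewrite (der_on_partial k Hz (der_onN uz)) -rowE !mxE.
have dp k : has_grad (partial k (fun z => - u z)) a.
  apply: (@has_grad_near (fun z => - partial k u z)) => //.
    by apply: filterS du => z h Hz; rewrite pN//; exact: h.
  by apply: der_on_has_grad => //; apply: der_onN; exact: d2u.
have pp k l : partial l (partial k (fun z => - u z)) a = - partial l (partial k u) a.
  rewrite (@partial_near (fun z => - partial k u z)) //.
  - by rewrite (der_on_partial l Ha (der_onN (d2u k))) -rowE !mxE.
  - by apply: filterS du => z h Hz; rewrite pN//; exact: h.
  - by apply: der_on_has_grad => //; apply: der_onN; exact: d2u.
split; [|exact: dp|].
- apply: filterS du => z h Hz; apply: der_on_has_grad => //.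
  by apply: der_onN; exact: h.
- move=> k l.
  exact (etrans (pp l k) (etrans (congr1 -%R (sym k l)) (esym (pp k l)))).
Qed.

End HalfspaceCalculus.

(** * From smooth extensions to second derivatives on the half-space *)

Section SmoothC2.
Context {R : realType} {n : nat}.
Local Notation E := 'rV[R]_n.+1.
Local Notation H := (@halfspace R n).

(** [g] continues [u] across the boundary: Schwarz's theorem as proved above needs a full
    neighbourhood and is applied to [g]. *)
Definition c2_extension (u : E -> R) (a : E) :=
  exists (U : set E) (g : E -> R),
    [/\ open U, U a, (forall z, U z -> H z -> u z = g z),
        forall z, U z -> exists L, der_on setT g z L
      & forall v z, U z -> exists L, der_on setT ('D_v g) z L].

Lemma c2_extension_at u a : H a -> c2_extension u a -> c2_at u a.
Proof.
move=> Ha [U [g [oU Ua ug dg d2g]]].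
have nU z : U z -> \forall y \near z, U y by move=> Uz; exact: open_nbhs_nbhs.
have der z L : U z -> H z -> der_on setT g z L -> der_on H u z L.
  move=> Uz Hz gL; apply: (@der_on_near _ _ _ _ g) => //.
    by apply: filterS (nU z Uz) => y Uy Hy; rewrite ug.
  exact: der_on_sub gL.
(* One-sided partials of [u] are full directional derivatives of [g], from which they inherit
   differentiability and symmetry. *)
have pE k z : U z -> H z -> partial k u z = 'D_(delta_mx 0 k) g z.
  move=> Uz Hz; have [L gL] := dg z Uz.
  rewrite (der_on_partial k Hz (der z L Uz Hz gL)).
  by have [_ ->] := der_on_is_derive (delta_mx 0 k) gL.
have der2 k L : der_on setT ('D_(delta_mx 0 k) g) a L -> der_on H (partial k u) a L.
  move=> gL; apply: (@der_on_near _ _ _ _ ('D_(delta_mx 0 k) g)) => //.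
    by apply: filterS (nU a Ua) => y Uy Hy; rewrite pE.
  exact: der_on_sub gL.
split.
- apply: filterS (nU a Ua) => z Uz Hz; have [L gL] := dg z Uz.
  exact/der_on_has_grad/der/gL.
- move=> k; have [L gL] := d2g (delta_mx 0 k) a Ua.
  exact/der_on_has_grad/der2/gL.
- move=> k l.
  have [L gL] := d2g (delta_mx 0 k) a Ua.
  have [M gM] := d2g (delta_mx 0 l) a Ua.
  rewrite (der_on_partial k Ha (der2 _ _ gM)) (der_on_partial l Ha (der2 _ _ gL)).
  have [_ <-] := der_on_is_derive (delta_mx 0 k) gM.
  have [_ <-] := der_on_is_derive (delta_mx 0 l) gL.
  by apply: (derive_sym _ gM gL); apply: filterS (nU a Ua) => z /dg.
Qed.

Lemma smooth_on_c2 (B : set E) (u : E -> R) a : H a -> B a ->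
  (\forall z \near a, H z -> B z) -> smooth_on B u -> c2_at u a.
Proof.
move=> Ha Ba HB /(_ _ Ba)[U [g [oU Ua /(_ 2%N)/= [dg d2g] ug]]].
apply: c2_extension_at => //.
(* The extension agrees with [u] only on [B]; after shrinking [U], its points in the half-space lie
   in [B]. *)
exists (U `&` interior [set z | H z -> B z]), g; split.
- by apply: openI => //; exact: open_interior.
- by split=> //; apply/nbhs_interior: HB.
- by move=> z [Uz /interior_subset/= Bz] Hz; apply: ug; split=> //; exact: Bz.
- by move=> z [Uz _]; eexists; apply: differentiable_der_on; exact: dg.
- by move=> v z [Uz _]; eexists; apply: differentiable_der_on; case: (d2g v) => + _; exact.
Qed.

Lemma smooth_on_entry_c2 (p q : nat) (B : set E) (M : E -> 'M[R]_(p, q)) a i j :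
  H a -> B a -> (\forall z \near a, H z -> B z) -> smooth_on B M ->
  c2_at (fun z => M z i j) a.
Proof.
move=> Ha Ba HB /(_ _ Ba)[U [g [oU Ua /(_ 2%N)/= [dg d2g] ug]]].
apply: c2_extension_at => //.
have nU z : U z -> \forall y \near z, U y by move=> Uz; exact: open_nbhs_nbhs.
have dge z : U z -> der_on setT (fun z => g z i j) z (fun x => 'd g z x i j).
  by move=> Uz; apply/der_on_entry/differentiable_der_on/dg.
exists (U `&` interior [set z | H z -> B z]), (fun z => g z i j); split.
- by apply: openI => //; exact: open_interior.
- by split=> //; apply/nbhs_interior: HB.
- move=> z [Uz /interior_subset/= Bz] Hz; congr (_ _ i j).
  by apply: ug; split=> //; exact: Bz.
- by move=> z [Uz _]; eexists; exact: dge.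
- move=> v z [Uz _]; exists (fun x => 'd ('D_v g) z x i j).
  apply: (@der_on_near _ _ _ _ (fun z => 'D_v g z i j)) => //.
    apply: filterS (nU z Uz) => y Uy _.
    have [_ ->] := der_on_is_derive v (dge _ Uy).
    by rewrite deriveE//; exact: dg.
  by apply/der_on_entry/differentiable_der_on; case: (d2g v) => + _; exact.
Qed.

End SmoothC2.

(** * Maps between charts and the boundary *)

Section Charts.
Context {R : realType} {n : nat} (N : bmanifold R n).
Local Notation E := 'rV[R]_n.+1.
Local Notation H := (@halfspace R n).
Implicit Types (i j k : midx N) (x : N) (f g : N -> N) (u : N -> R).

Lemma chart_at_dom x : mdom (chart_at x) x.
Proof. exact: projT2 (cid (mdom_cover x)). Qed.

Lemma mchart_halfspace i x : mdom i x -> H (mchart i x).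
Proof.
move=> ix; have [U oU e] := mimage_open i.
by have : (mchart i @` mdom i) (mchart i x) by [exists x]; rewrite e => -[].
Qed.

Lemma near_mchart i x (P : E -> Prop) : mdom i x ->
  (\forall z \near mchart i x, P z) -> \forall y \near x, P (mchart i y).
Proof.
move=> ix nP.
have /subspace_continuousP/(_ x ix) := @mchart_continuous R n N i.
move=> /(_ _ nP) h.
have {}h : \forall y \near x, mdom i y -> P (mchart i y) by exact: h.
have hi : \forall y \near x, mdom i y by apply: open_nbhs_nbhs; split=> //; exact: mdom_open.
near=> y; have : mdom i y -> P (mchart i y) by near: y.
by apply; near: y.
Unshelve. all: by end_near. Qed.

(** The image of a chart is relatively open in the half-space, so points of the half-space close to
    [mchart i x] are coordinates of points of the domain. *)
Lemma near_minv i x (P : N -> Prop) : mdom i x -> (\forall y \near x, P y) ->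
  \forall z \near mchart i x,
    H z -> [/\ mdom i (minv i z), mchart i (minv i z) = z & P (minv i z)].
Proof.
move=> ix nP; have [U oU e] := mimage_open i.
have Bx : (mchart i @` mdom i) (mchart i x) by exists x.
have /subspace_continuousP/(_ _ Bx) := @minv_continuous R n N i.
have nP' : nbhs (minv i (mchart i x)) P by rewrite mchartK.
move=> /(_ _ nP'); rewrite e => h.
have {}h : \forall z \near mchart i x, (U `&` H) z -> P (minv i z) by exact: h.
have [Ux Hx] : (U `&` H) (mchart i x) by rewrite -e.
have nU : \forall z \near mchart i x, U z by exact: open_nbhs_nbhs.
near=> z => Hz.
have Uz : U z by near: z.
have : (U `&` H) z by [].
rewrite -e => -[y iy yz]; split.
- by rewrite -yz mchartK.
- by rewrite -yz mchartK.
- have : (U `&` H) z -> P (minv i z) by near: z.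
  exact.
Unshelve. all: by end_near. Qed.

Lemma near_minvK i x : mdom i x -> \forall z \near mchart i x,
  H z -> mdom i (minv i z) /\ mchart i (minv i z) = z.
Proof.
move=> ix; have nx : \forall y \near x, mdom i y.
  by apply: open_nbhs_nbhs; split=> //; exact: mdom_open.
by apply: filterS (near_minv ix nx) => z h /h[].
Qed.

(** For [f = id] this is a transition map, and [local_jac id i j] is [transition_jac i j]. *)
Definition local_map f i j : E -> E := mchart j \o f \o minv i.

Definition local_jac f i j x : 'M[R]_n.+1 := jac (local_map f i j) (mchart i x).

Definition c2_map f := continuous f /\ forall i j x, mdom i x -> mdom j (f x) ->
  forall l, c2_at (fun z => local_map f i j z 0 l) (mchart i x).

Definition c2_fun u := forall i x, mdom i x -> c2_at (u \o minv i) (mchart i x).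

Lemma local_mapE f i j x : mdom i x -> local_map f i j (mchart i x) = mchart j (f x).
Proof. by move=> ix; rewrite /local_map/= mchartK. Qed.

Lemma near_dom (f : N -> N) j x : continuous f -> mdom j (f x) ->
  \forall y \near x, mdom j (f y).
Proof.
move=> cf jx; apply: cf; apply: open_nbhs_nbhs; split=> //; exact: mdom_open.
Qed.

Lemma near_local_map_halfspace f i j x : continuous f -> mdom i x -> mdom j (f x) ->
  \forall z \near mchart i x, H z -> H (local_map f i j z).
Proof.
move=> cf ix jx; apply: filterS (near_minv ix (near_dom cf jx)) => z h Hz.
by have [_ _ jz] := h Hz; exact: mchart_halfspace.
Qed.

Lemma smooth_map_c2 f : smooth_map f -> c2_map f.
Proof.
move=> [cf sf]; split; first exact: cf.
move=> i j x ix jx l.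
apply: (@smooth_on_entry_c2 _ _ 1 n.+1 _ (local_map f i j) _ 0 l _ _ _ (sf i j)).
- exact: mchart_halfspace.
- by exists x.
- apply: filterS (near_minv ix (near_dom cf jx)) => z h /h[h1 h2 h3].
  by exists (minv i z).
Qed.

Lemma smooth_fun_c2 u : smooth_fun u -> c2_fun u.
Proof.
move=> su i x ix; apply: smooth_on_c2 (su i).
- exact: mchart_halfspace.
- by exists x.
- by apply: filterS (near_minvK ix) => z h /h[h1 h2]; exists (minv i z).
Qed.

Lemma c2_map_id : c2_map id.
Proof.
apply: smooth_map_c2; split; first by move=> x; exact: cvg_id.
by move=> i j; exact: (@mtransition_smooth R n N i j).
Qed.

Lemma c2_map_has_jac f i j x : c2_map f -> mdom i x -> mdom j (f x) ->
  has_jac (local_map f i j) (mchart i x).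
Proof.
move=> [_ cf] ix jx; apply: has_jac_entries => l.
by apply: c2_has_grad (cf i j x ix jx l); exact: mchart_halfspace.
Qed.

(** The local expressions compose only near [mchart i x], where [f] lands in the chart [j]; the
    Jacobian depends on nothing else. *)
Lemma local_jac_comp f g i j k x : c2_map f -> c2_map g -> mdom i x ->
  mdom j (f x) -> mdom k (g (f x)) ->
  local_jac (g \o f) i k x = local_jac f i j x *m local_jac g j k (f x).
Proof.
move=> cf cg ix jx kx.
have Hx := mchart_halfspace ix.
have jf := c2_map_has_jac cf ix jx.
have jg := c2_map_has_jac cg jx kx.
have hH := near_local_map_halfspace cf.1 ix jx.
rewrite -(local_mapE f j ix) in jg.
have [d e] := has_jac_comp Hx jf jg hH.
rewrite [in RHS]/local_jac -(local_mapE f j ix).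
refine (etrans _ e); apply: jac_near d => //.
apply: filterS (near_minv ix (near_dom cf.1 jx)) => z h /h[h1 h2 h3].
by rewrite /local_map/= mchartK.
Qed.

Lemma local_jac_id i x : mdom i x -> local_jac id i i x = 1%:M.
Proof.
move=> ix; have Hx := mchart_halfspace ix.
apply: (der_on_jac Hx).
apply: (@der_on_near _ _ _ _ id) => //.
  by apply: filterS (near_minvK ix) => z h /h[h1 h2]; rewrite /local_map/= h2.
apply: (@eq_der_on _ _ _ _ _ _ id); first by move=> y; rewrite mulmx1.
by apply: linear_bound_der_on => //; exists 1 => y; rewrite mul1r.
Qed.

Lemma local_jacK f f' i j x : c2_map f -> c2_map f' -> cancel f f' ->
  mdom i x -> mdom j (f x) -> local_jac f i j x *m local_jac f' j i (f x) = 1%:M.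
Proof.
move=> cf cf' fK ix jx; rewrite -local_jac_comp// ?fK//.
by rewrite (_ : f' \o f = id) ?local_jac_id//; apply/funext => y /=; rewrite fK.
Qed.

Lemma differential_comp f u i j x : c2_map f -> c2_fun u -> mdom i x ->
  mdom j (f x) ->
  differential (u \o f) i x = local_jac f i j x *m differential u j (f x).
Proof.
move=> cf cu ix jx.
have Hx := mchart_halfspace ix.
have jf := c2_map_has_jac cf ix jx.
have du := c2_has_grad (mchart_halfspace jx) (cu j _ jx).
have hH := near_local_map_halfspace cf.1 ix jx.
have -> : differential u j (f x) = grad (u \o minv j) (local_map f i j (mchart i x)).
  by rewrite local_mapE.
rewrite -(local_mapE f j ix) in du.
have [d e] := has_grad_comp Hx jf du hH.
refine (etrans _ e); apply: grad_near d => //.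
apply: filterS (near_minv ix (near_dom cf.1 jx)) => z h /h[h1 h2 h3].
by rewrite /local_map/= mchartK.
Qed.

Lemma c2_fun_comp f u : c2_map f -> c2_fun u -> c2_fun (u \o f).
Proof.
move=> cf cu i x ix.
have jx := chart_at_dom (f x); set j := chart_at (f x) in jx.
have Hx := mchart_halfspace ix.
have hH := near_local_map_halfspace cf.1 ix jx.
have e : \forall z \near mchart i x, H z ->
    (u \o minv j \o local_map f i j) z = (u \o f \o minv i) z.
  apply: filterS (near_minv ix (near_dom cf.1 jx)) => z h /h[h1 h2 h3].
  by rewrite /local_map/= mchartK.
apply: (c2_near Hx e); apply: (c2_comp Hx _ _ hH).
  by move=> l; exact: cf.2.
by rewrite (local_mapE f j ix); exact: (cu j _ jx).
Qed.

Lemma c2_funN u : c2_fun u -> c2_fun (fun x => - u x).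
Proof. by move=> cu i x ix; apply: c2N; [exact: mchart_halfspace|exact: cu]. Qed.

Lemma differentialN u i x : c2_fun u -> mdom i x ->
  differential (fun x => - u x) i x = - differential u i x.
Proof.
move=> cu ix; have Hx := mchart_halfspace ix.
apply: (der_on_grad Hx).
apply: eq_der_on (der_onN (c2_has_grad Hx (cu i x ix))) => y.
by rewrite mulmxN [RHS]mxE.
Qed.

Lemma c2_fun_continuous u : c2_fun u -> continuous u.
Proof.
move=> cu x.
have ix := chart_at_dom x; set i := chart_at x in ix.
have Hx := mchart_halfspace ix.
apply/cvgrPdist_lt => e e0.
have := der_on_cvg (c2_has_grad Hx (cu i x ix)) e0.
move=> /(near_mchart ix) h.
have hi : \forall y \near x, mdom i y by apply: open_nbhs_nbhs; split=> //; exact: mdom_open.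
near=> y.
have iy : mdom i y by near: y.
have : H (mchart i y) -> `|(u \o minv i) (mchart i y) - (u \o minv i) (mchart i x)| < e.
  by near: y.
by move=> /(_ (mchart_halfspace iy)); rewrite /= !mchartK// distrC.
Unshelve. all: by end_near. Qed.

End Charts.

(** * Invariance of the boundary and first derivatives at its points *)

Section Boundary.
Context {R : realType} {n : nat} (N : bmanifold R n).
Local Notation E := 'rV[R]_n.+1.
Local Notation H := (@halfspace R n).
Implicit Types (i j k : midx N) (x : N) (f g : N -> N) (u : N -> R) (xi : E).

Lemma near_interior_halfspace (a : E) : 0 < a 0 0 -> \forall z \near a, H z.
Proof.
move=> a0; apply/nbhs_normP; exists (a 0 0) => // z; rewrite /ball_/= => za.
rewrite /halfspace/=.
have : `|(a - z) 0 0| < a 0 0 by apply: le_lt_trans za; exact: ler_entry_norm.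
by rewrite !mxE => /ltr_normlW; rewrite ltrBlDr -ltrBlDl subrr => /ltW.
Qed.

(** If the coordinate were positive, the transition map to a chart showing [x] on the boundary would
    send a full neighbourhood into the half-space. Its index 0 component, minimal at [x], would have
    derivative zero in every direction, against the invertibility of the Jacobian. *)
Lemma boundary_mchart x j : mboundary x -> mdom j x -> mchart j x 0 0 = 0.
Proof.
move=> [i ix x0] jx.
have Hx : 0 <= mchart j x 0 0 := mchart_halfspace jx.
apply/eqP; move: Hx; rewrite le_eqVlt eq_sym => /orP[//|a0].
have jac_id := c2_map_has_jac (c2_map_id N) jx ix.
have /(der_on_entry 0 0) d0 := jac_id.
have near_ge0 : \forall z \near mchart j x, H z /\ 0 <= local_map id j i z 0 0.
  have h1 := near_interior_halfspace a0.
  have h2 := near_local_map_halfspace (c2_map_id N).1 jx ix.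
  near=> z; have Hz : H z by near: z.
  split; first exact: Hz.
  by have /(_ Hz) : H z -> H (local_map id j i z) by near: z; exact: h2.
have ge0 xi : 0 <= (xi *m local_jac id j i x) 0 0.
  apply: (der_on_dir_ge0 d0); first by rewrite (local_mapE id i jx); exact: x0.
  exact: (near_ray xi near_ge0).
have eq0 xi : (xi *m local_jac id j i x) 0 0 = 0.
  apply/eqP; rewrite eq_le ge0 andbT -oppr_ge0.
  by have := ge0 (- xi); rewrite mulNmx mxE.
have := local_jacK (c2_map_id N) (c2_map_id N) (fun=> erefl) ix jx.
move=> /(congr1 (fun M : 'M[R]_n.+1 => row 0 M 0 0)).
rewrite row_mul eq0 !mxE eqxx => /eqP.
by rewrite eq_sym oner_eq0.
Unshelve. all: by end_near. Qed.

(** Along a tangent direction the coordinate of index 0 stays zero, so a short ray consists of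
    boundary points, where fixed points and vanishing functions are known. *)
Lemma near_tangent_ray x i xi (P : E -> Prop) : mboundary x -> mdom i x ->
  tangent_to_boundary xi ->
  (\forall z \near mchart i x, H z -> mboundary (minv i z) ->
     mdom i (minv i z) -> mchart i (minv i z) = z -> P z) ->
  \forall t \near (0 : R)^'+, H (mchart i x + t *: xi) /\ P (mchart i x + t *: xi).
Proof.
move=> bx ix t0 nP.
have h1 := near_ray xi nP; have h2 := near_ray xi (near_minvK ix).
have z0 (t : R) : (mchart i x + t *: xi) 0 0 = 0.
  by rewrite !mxE (boundary_mchart bx ix) t0 mulr0 addr0.
near=> t.
have Hz : H (mchart i x + t *: xi) by rewrite /halfspace/= z0.
split=> //; set z := _ + _ in Hz *.
have [iz zK] : mdom i (minv i z) /\ mchart i (minv i z) = z.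
  by move: Hz; rewrite /z; near: t.
have bz : mboundary (minv i z) by exists i => //; rewrite zK z0.
by move: Hz bz iz zK; rewrite /z; near: t.
Unshelve. all: by end_near. Qed.

Section FixedBoundary.
Variable f : N -> N.
Hypotheses (cf : c2_map f) (f_bd : forall x, mboundary x -> f x = x).

Lemma local_jac_tangent i x xi : mboundary x -> mdom i x -> tangent_to_boundary xi ->
  xi *m local_jac f i i x = xi.
Proof.
move=> bx ix t0.
have fx := f_bd bx.
have fix_ : mdom i (f x) by rewrite fx.
apply: (der_on_dir_eq (c2_map_has_jac cf ix fix_)).
have h : \forall z \near mchart i x, H z -> mboundary (minv i z) ->
    mdom i (minv i z) -> mchart i (minv i z) = z -> local_map f i i z = z.
  by near=> z => Hz bz iz zK; rewrite /local_map/= f_bd.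
apply: filterS (near_tangent_ray bx ix t0 h) => t [Hz e]; split; first exact: Hz.
by rewrite e (local_mapE f i ix) fx addrC addKr.
Unshelve. all: by end_near. Qed.

(** As tangent vectors are fixed, the index 0 component is multiplied by a constant factor. It is
    nonnegative since the half-space goes to itself, and nonzero since the Jacobian is
    invertible. *)
Lemma local_jac_inward f' i x xi : c2_map f' -> cancel f f' -> cancel f' f ->
  mboundary x -> mdom i x -> strictly_inward xi ->
  strictly_inward (xi *m local_jac f i i x).
Proof.
move=> cf' fK f'K bx ix xi0.
have fx := f_bd bx.
have fix_ : mdom i (f x) by rewrite fx.
have Hx := mchart_halfspace ix.
pose e : E := delta_mx 0 0.
have E1 (eta : E) : (eta *m local_jac f i i x) 0 0 =
    eta 0 0 * (e *m local_jac f i i x) 0 0.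
  rewrite -{1}(subrK (eta 0 0 *: e) eta) mulmxDl local_jac_tangent//; last first.
    by rewrite /tangent_to_boundary !mxE !eqxx mulr1 subrr.
  by rewrite -scalemxAl !mxE !eqxx mulr1 subrr add0r.
rewrite /strictly_inward E1 mulr_gt0// lt_neqAle; apply/andP; split.
  apply/eqP => e0.
  have f'x : f' x = x by rewrite -{1}fx fK.
  have := local_jacK cf' cf f'K ix (_ : mdom i (f' x)); rewrite f'x => /(_ ix).
  move=> /(congr1 (fun M : 'M[R]_n.+1 => row 0 M 0 0)).
  rewrite row_mul E1 -e0 mulr0 !mxE eqxx => /esym/eqP.
  by rewrite oner_eq0.
have /(der_on_entry 0 0) d0 := c2_map_has_jac cf ix fix_.
apply: (der_on_dir_ge0 d0).
  by rewrite (local_mapE f i ix) fx (boundary_mchart bx ix).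
have h := near_ray e (near_local_map_halfspace cf.1 ix fix_).
near=> t.
have t0 : 0 < t by near: t; exact: nbhs_right_gt.
have Ht := halfspace_add 0 Hx (ltW t0).
by split=> //; move: Ht; near: t.
Unshelve. all: by end_near. Qed.

Lemma differential_tangent u i x xi : c2_fun u -> (forall x, mboundary x -> u x = 0) ->
  mboundary x -> mdom i x -> tangent_to_boundary xi ->
  (xi *m differential u i x) 0 0 = 0.
Proof.
move=> cu u0 bx ix t0.
have Hx := mchart_halfspace ix.
apply: (der_on_dir_eq (c2_has_grad Hx (cu i x ix))).
have h : \forall z \near mchart i x, H z -> mboundary (minv i z) ->
    mdom i (minv i z) -> mchart i (minv i z) = z -> u (minv i z) = 0.
  by near=> z => Hz bz iz zK; exact: u0.
apply: filterS (near_tangent_ray bx ix t0 h) => t [Hz e]; split; first exact: Hz.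
by rewrite /= e mchartK// u0// subrr [RHS]mulr0.
Unshelve. all: by end_near. Qed.

End FixedBoundary.
End Boundary.

(** * The differential of the lifted map *)

Section ProductJacobian.
Context {R : realType} {n : nat} (N : bmanifold R n).
Local Notation E := 'rV[R]_n.+1.
Local Notation H := (@halfspace R n).

Section PushForward.
Variables (f : N -> N) (phi : N -> R).
Hypotheses (cf : c2_map f) (cphi : c2_fun phi).

(* The isometry [(t, x) |-> (t - phi x, f x)] from [g'] to [g], its differential,
   and the matrix of the differential in the charts [i] and [j]. *)
Definition lift_map (p : spacetime N) : spacetime N := (p.1 - phi p.2, f p.2).

Definition push (p : spacetime N) (v : tspace) : @tspace R n :=
  let i := chart_at p.2 in
  (v.1 - (v.2 *m differential phi i p.2) 0 0,
   v.2 *m local_jac f i (chart_at (f p.2)) p.2).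

Definition lift_jac (i j : midx N) (z : E) : 'M[R]_(1 + n.+1) :=
  block_mx 1 0 (- grad (phi \o minv i) z) (jac (local_map f i j) z).

Lemma row_mul_block1 p q (a : R) (xi : 'rV[R]_p) (C : 'cV[R]_p) (D : 'M[R]_(p, q)) :
  row_mx a%:M xi *m block_mx (1 : 'M[R]_1) 0 C D =
  row_mx (a + (xi *m C) 0 0)%:M (xi *m D).
Proof.
rewrite mul_row_block mulmx1 mulmx0 add0r; congr row_mx.
by apply/matrixP => k l; rewrite !ord1 !mxE !eqxx !mulr1n.
Qed.

Lemma push_row (p : spacetime N) v :
  row_mx (push p v).1%:M (push p v).2 =
  row_mx v.1%:M v.2 *m
    lift_jac (chart_at p.2) (chart_at (f p.2)) (mchart (chart_at p.2) p.2).
Proof. by rewrite row_mul_block1 mulmxN [(- (_ *m _)) 0 0]mxE. Qed.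

Lemma tcoordE (x : N) i xi : tcoord x i xi = xi *m local_jac id (chart_at x) i x.
Proof. by []. Qed.

(** [push] is written in the preferred charts; the chain rule for [id \o f = f \o id] transfers it
    to any pair of charts. *)
Lemma tcoordM_push (p : spacetime N) v i j : mdom i p.2 -> mdom j (f p.2) ->
  tcoordM j (lift_map p) (push p v) = tcoordM i p v *m lift_jac i j (mchart i p.2).
Proof.
case: p => t x /= ix jx; have cx := chart_at_dom x; have cfx := chart_at_dom (f x).
rewrite /tcoordM/= row_mul_block1 !tcoordE -!mulmxA; congr row_mx.
  congr (_%:M); rewrite !mulmxN [(- (_ *m _)) 0 0]mxE; congr (_ - _).
  have -> : grad (phi \o minv i) (mchart i x) = differential phi i x by [].
  by rewrite -(differential_comp (c2_map_id N) cphi cx ix).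
have -> : jac (local_map f i j) (mchart i x) = local_jac f i j x by [].
rewrite -(local_jac_comp cf (c2_map_id N) cx cfx jx).
by rewrite -(local_jac_comp (c2_map_id N) cf cx ix jx).
Qed.

End PushForward.
End ProductJacobian.

(** * Stationary metrics and their geodesics *)

Section Lagrange.
Context {R : realType} {n : nat}.
Local Notation E := 'rV[R]_n.+1.
Local Notation H := (@halfspace R n).
Local Notation dim := (1 + n.+1)%N.

(* A curve of velocity [v] is a geodesic of [G] iff its acceleration [a] satisfies
   [a *m G = lagrange_force DG v]. Since [G] does not depend on [t], the
   derivative [DG] takes only the component of [v] tangent to [N]. *)
Definition lagrange_force (DG : E -> 'M[R]_dim) (v : 'rV[R]_dim) : 'rV[R]_dim :=
  \row_l (2^-1 * (v *m DG (rsubmx (delta_mx 0 l)) *m v^T) 0 0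
          - (v *m DG (rsubmx v)) 0 l).

Lemma sum_rsubmx (DG : E -> 'M[R]_dim) (v : 'rV[R]_dim) : linear DG ->
  DG (rsubmx v) = \sum_a v 0 a *: DG (rsubmx (delta_mx 0 a)).
Proof.
move=> lDG; rewrite {1}(row_sum_delta v) linear_sum (linear_sumf lDG).
by apply: eq_bigr => a _; rewrite linearZ (linearZf lDG).
Qed.

(** The Euler-Lagrange expression tested against [w]: a form without indices, suited to a change of
    variables. *)
Lemma lagrange_forceE DG v (w : 'rV[R]_dim) : linear DG ->
  (lagrange_force DG v *m w^T) 0 0 =
  2^-1 * (v *m DG (rsubmx w) *m v^T) 0 0 - (v *m DG (rsubmx v) *m w^T) 0 0.
Proof.
move=> lDG; rewrite (sum_rsubmx w lDG).
rewrite mulmx_sumr mulmx_suml summxE mulr_sumr.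
rewrite [X in _ = _ - X]mxE -sumrB mxE; apply: eq_bigr => l _.
rewrite [lagrange_force _ _ 0 l]mxE [w^T l 0]mxE -scalemxAr -scalemxAl.
rewrite [(_ *: _ : 'M[R]_1) 0 0]mxE.
by ring.
Qed.

Lemma mx11_tr (A : 'M[R]_1) : A^T = A.
Proof. by apply/matrixP => i j; rewrite mxE !ord1. Qed.

Lemma add00 (A B : 'M[R]_1) : (A + B) 0 0 = A 0 0 + B 0 0.
Proof. by rewrite mxE. Qed.

(** The derivative of [J] along [w] enters twice with weight one half through the quadratic term,
    and once with the opposite sign, by [symJ], through the derivative along the curve. These
    contributions cancel. *)
Lemma lagrange_transport (G J : 'M[R]_dim) (Jr : 'M[R]_n.+1)
    (DG DG' DJ : E -> 'M[R]_dim) (v a : 'rV[R]_dim) :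
  linear DG -> linear DG' -> G^T = G -> J \in unitmx ->
  (forall w : 'rV[R]_dim, rsubmx (w *m J) = rsubmx w *m Jr) ->
  (forall xi, DG' xi = DJ xi *m G *m J^T + J *m DG (xi *m Jr) *m J^T
                       + J *m G *m (DJ xi)^T) ->
  (forall w : 'rV[R]_dim, w *m DJ (rsubmx v) = v *m DJ (rsubmx w)) ->
  a *m (J *m G *m J^T) = lagrange_force DG' v ->
  (a *m J + v *m DJ (rsubmx v)) *m G = lagrange_force DG (v *m J).
Proof.
move=> lDG lDG' Gs Ju rJ eDG' symJ ea.
(* Since [J] is invertible, the vectors [w *m J] are all the test vectors. *)
suff h (w : 'rV[R]_dim) :
    ((a *m J + v *m DJ (rsubmx v)) *m G *m (w *m J)^T) 0 0 =
    (lagrange_force DG (v *m J) *m (w *m J)^T) 0 0.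
  apply/rowP => l; have := h (delta_mx 0 l *m invmx J).
  by rewrite mulmxKV// trmx_delta -!colE !mxE.
have h := lagrange_forceE v w lDG'; rewrite -ea in h.
rewrite (lagrange_forceE _ _ lDG) !rJ.
pose V := v *m J; pose W := w *m J; pose X := v *m DJ (rsubmx v).
pose Y := v *m DJ (rsubmx w).
have e1 : (v *m DG' (rsubmx w) *m v^T) 0 0 =
    2 * (V *m G *m Y^T) 0 0 + (V *m DG (rsubmx w *m Jr) *m V^T) 0 0.
  rewrite eDG' !mulmxDr !mulmxDl !add00.
  have -> : v *m (J *m G *m (DJ (rsubmx w))^T) *m v^T = V *m G *m Y^T.
    by rewrite /V /Y trmx_mul !mulmxA.
  have -> : v *m (J *m DG (rsubmx w *m Jr) *m J^T) *m v^T =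
     V *m DG (rsubmx w *m Jr) *m V^T by rewrite /V trmx_mul !mulmxA.
  have -> : v *m (DJ (rsubmx w) *m G *m J^T) *m v^T = V *m G *m Y^T.
    by rewrite -[RHS]mx11_tr !trmx_mul !trmxK Gs /V /Y ?trmx_mul !mulmxA.
  by ring.
have e2 : (v *m DG' (rsubmx v) *m w^T) 0 0 =
    (X *m G *m W^T) 0 0 + (V *m DG (rsubmx v *m Jr) *m W^T) 0 0
    + (V *m G *m Y^T) 0 0.
  rewrite eDG' !mulmxDr !mulmxDl !add00.
  congr (_ + _ + _).
  - by rewrite /X /W trmx_mul !mulmxA.
  - by rewrite /V /W trmx_mul !mulmxA.
  (* The symmetry of the second derivatives turns this term into the one that occurs in [e1]. *)
  - by rewrite /V /Y -symJ trmx_mul !mulmxA.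
have e3 : (a *m (J *m G *m J^T) *m w^T) 0 0 = (a *m J *m G *m W^T) 0 0.
  by rewrite /W trmx_mul !mulmxA.
rewrite e1 e2 e3 in h.
rewrite mulmxDl mulmxDl add00 -/V -/W -/X h.
by field.
Qed.

End Lagrange.

(** * Nondegeneracy and pullback of the metric *)

Section StationaryMetric.
Context {R : realType} {n : nat} (N : bmanifold R n).
Local Notation E := 'rV[R]_n.+1.
Local Notation H := (@halfspace R n).
Local Notation dim := (1 + n.+1)%N.

Section OneMetric.
Variables (h : midx N -> N -> 'M[R]_n.+1) (om : midx N -> N -> 'cV[R]_n.+1)
  (lam : N -> R).
Hypotheses (hh : riemannian_metric h) (hom : one_form om) (hlam : c2_fun lam)
  (lam_pos : forall x, 0 < lam x).

Lemma stationary_metric_sym i x : mdom i x ->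
  (stationary_metric h om lam i x)^T = stationary_metric h om lam i x.
Proof.
move=> ix; case: hh => _ hs _ _; rewrite /stationary_metric.
rewrite linearD/= linearZ/= trmx_mul trmxK; congr (_ + _).
by rewrite tr_block_mx !trmx0 hs.
Qed.

Lemma stationary_metric_unit i x : mdom i x ->
  stationary_metric h om lam i x \in unitmx.
Proof.
move=> ix; case: hh => _ hs hp _.
have hu : h i x \in unitmx.
  (* A nonzero vector of the kernel would have length zero for the positive definite [h]. *)
  rewrite -row_free_unit -kermx_eq0; apply/eqP/row_matrixP => k; rewrite row0.
  apply/eqP/negP => /negP k0.
  have := hp i x _ ix k0.
  by rewrite -row_mul mulmx_ker row0 mul0mx mxE ltxx.
(* The lower rows of [B] are the lifts of the coordinate vectors of [N] on which [dt - om] vanishes;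
   with [d/dt] they form a frame in which the metric is block diagonal. *)
pose B : 'M[R]_dim := block_mx 1%:M 0 (om i x) 1%:M.
have Bu : B \in unitmx.
  by rewrite unitmxE det_lblock !det1 mulr1 unitr1.
have e : B *m stationary_metric h om lam i x *m B^T =
    block_mx (- lam x)%:M 0 0 (h i x).
  rewrite /stationary_metric mulmxDr mulmxDl -scalemxAr -scalemxAl.
  have -> : B *m (col_mx 1%:M (- om i x) *m (col_mx 1%:M (- om i x))^T) *m B^T =
      (B *m col_mx 1%:M (- om i x)) *m (B *m col_mx 1%:M (- om i x))^T.
    by rewrite trmx_mul !mulmxA.
  have -> : B *m col_mx 1%:M (- om i x) = col_mx 1%:M 0.
    by rewrite mul_block_col !mul1mx mul0mx addr0 mulmx1 subrr.
  rewrite tr_col_mx mul_col_row tr_block_mx !mulmx_block !(trmx0, trmx1).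
  rewrite !(mulmx0, mul0mx, mulmx1, mul1mx, addr0, add0r).
  rewrite scale_block_mx !scaler0 add_block_mx !addr0 !add0r.
  by rewrite scalemx1.
have : B *m stationary_metric h om lam i x *m B^T \in unitmx.
  rewrite e unitmxE det_ublock det_scalar1 unitrM -unitmxE hu andbT.
  by rewrite unitfE oppr_eq0 gt_eqF.
by rewrite unitmx_mul => /andP[]; rewrite unitmx_mul => /andP[].
Qed.

Lemma chart_nbhs i x : mdom i x ->
  \forall z \near mchart i x, H z -> (@mchart R n N i @` @mdom R n N i) z.
Proof.
by move=> ix; apply: filterS (near_minvK ix) => z hz /hz[h1 h2]; exists (minv i z).
Qed.

Lemma stationary_metric_der i x : mdom i x ->
  exists DG : E -> 'M[R]_dim,
    der_on H (stationary_metric h om lam i \o minv i) (mchart i x) DG.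
Proof.
move=> ix.
have Hx := mchart_halfspace ix.
have Bx : (@mchart R n N i @` @mdom R n N i) (mchart i x) by exists x.
have nB := chart_nbhs ix.
case: hh => _ _ _ /(_ i) sh; case: hom => _ /(_ i) so.
have [Dh dh] : exists Dh : E -> 'M[R]_n.+1, der_on H (h i \o minv i) (mchart i x) Dh.
  eexists; apply: der_on_mx_grad => k l.
  exact (c2_has_grad Hx (smooth_on_entry_c2 k l Hx Bx nB sh)).
have [Do do_] : exists Do : E -> 'cV[R]_n.+1, der_on H (om i \o minv i) (mchart i x) Do.
  eexists; apply: der_on_mx_grad => k l.
  exact (c2_has_grad Hx (smooth_on_entry_c2 k l Hx Bx nB so)).
have dl := der_onN (c2_has_grad Hx (hlam ix)).
have da := der_on_col_mx (der_on_cst H (1%:M : 'M[R]_1) (mchart i x)) (der_onN do_).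
have db := der_on_block_mx (der_on_cst H (0 : 'M[R]_1) (mchart i x))
  (der_on_cst H (0 : 'rV[R]_n.+1) (mchart i x))
  (der_on_cst H (0 : 'cV[R]_n.+1) (mchart i x)) dh.
eexists.
exact (der_onD (der_on_scalemx dl (der_on_mulmx da (der_on_tr da))) db).
Qed.

End OneMetric.

Section Pullback.
Variables (h h' : midx N -> N -> 'M[R]_n.+1) (om om' : midx N -> N -> 'cV[R]_n.+1)
  (lam lam' : N -> R) (f : N -> N) (phi : N -> R).
Hypotheses
  (h_pull : forall i j x, mdom i x -> mdom j (f x) ->
     h' i x = local_jac f i j x *m h j (f x) *m (local_jac f i j x)^T)
  (om_pull : forall i j x, mdom i x -> mdom j (f x) ->
     om' i x = local_jac f i j x *m om j (f x) + differential phi i x)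
  (lam_pull : forall x, lam' x = lam (f x)).

Lemma stationary_metric_pull i j x : mdom i x -> mdom j (f x) ->
  let J := lift_jac f phi i j (mchart i x) in
  stationary_metric h' om' lam' i x = J *m stationary_metric h om lam j (f x) *m J^T.
Proof.
move=> ix jx J; rewrite /stationary_metric mulmxDr mulmxDl -scalemxAr -scalemxAl.
rewrite lam_pull; congr (_ *: _ + _).
  have -> : J *m (col_mx 1%:M (- om j (f x)) *m (col_mx 1%:M (- om j (f x)))^T) *m J^T =
      (J *m col_mx 1%:M (- om j (f x))) *m (J *m col_mx 1%:M (- om j (f x)))^T.
    by rewrite trmx_mul !mulmxA.
  suff -> : J *m col_mx 1%:M (- om j (f x)) = col_mx 1%:M (- om' i x) by [].
  rewrite mul_block_col !mul1mx mul0mx addr0 mulmx1 mulmxN (om_pull ix jx).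
  by rewrite opprD addrC.
rewrite tr_block_mx !mulmx_block !(mulmx0, mul0mx, addr0, add0r).
by rewrite (h_pull ix jx) -?mulmxA ?trmx0 ?mulmx0 ?mul0mx.
Qed.

End Pullback.
End StationaryMetric.

(** * Christoffel symbols and the Euler-Lagrange form *)

Section ChristoffelForce.
Context {R : realType} {n : nat}.
Local Notation E := 'rV[R]_n.+1.
Local Notation H := (@halfspace R n).
Local Notation dim := (1 + n.+1)%N.
Implicit Types (DG : E -> 'M[R]_dim) (v : 'rV[R]_dim).

(** The time direction follows the same formula as the others: for [a = 0] the vector
    [rsubmx (delta_mx 0 a)] is zero. *)
Lemma partial_rsubmx (g : E -> 'M[R]_dim) (y : 'rV[R]_dim) DG a b l :
  H (rsubmx y) -> der_on H g (rsubmx y) DG ->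
  partial a (fun z : 'rV[R]_dim => g (rsubmx z) b l) y =
  DG (rsubmx (delta_mx 0 a)) b l.
Proof.
move=> Hy gD.
have Hd : \forall t \near (0 : R)^'+,
    H (rsubmx y + t *: rsubmx (delta_mx 0 a : 'rV[R]_dim)).
  near=> t; have t0 : 0 < t by near: t; exact: nbhs_right_gt.
  rewrite /halfspace/= !mxE addr_ge0//; first by move: Hy; rewrite /halfspace/= mxE.
  by rewrite mulr_ge0// ltW.
have := der_on_dir (der_on_entry b l gD) Hd.
rewrite (_ : (fun t : R => _) = (fun t : R => t^-1 *:
    (g (rsubmx (y + t *: delta_mx 0 a)) b l - g (rsubmx y) b l))); last first.
  apply/funext => t; congr (_ *: (g _ b l - _)).
  by rewrite [RHS]linearD linearZ.
by move=> c; apply: cvg_lim c.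
Unshelve. all: by end_near. Qed.

Lemma sum_force DG v l : linear DG ->
  (v *m DG (rsubmx v)) 0 l =
  \sum_a \sum_b DG (rsubmx (delta_mx 0 a)) b l * v 0 a * v 0 b.
Proof.
move=> lDG; rewrite (sum_rsubmx v lDG) mulmx_sumr summxE; apply: eq_bigr => a _.
rewrite -scalemxAr [(_ *: _ : 'rV[R]_dim) 0 l]mxE [(_ *m _) 0 l]mxE mulr_sumr.
by apply: eq_bigr => b _; ring.
Qed.

Lemma sum_quadratic (M : 'M[R]_dim) v :
  (v *m M *m v^T) 0 0 = \sum_a \sum_b M a b * v 0 a * v 0 b.
Proof.
rewrite mxE exchange_big/=; apply: eq_bigr => b _.
rewrite [v^T b 0]mxE [(_ *m _) 0 b]mxE mulr_suml.
by apply: eq_bigr => a _; ring.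
Qed.

(** Once contracted with [v] twice, the first two derivatives in a Christoffel symbol coincide by
    exchanging [a] and [b]; the factor one half remains only on the third. *)
Lemma christoffel_force (g : E -> 'M[R]_dim) (y : 'rV[R]_dim) DG v :
  H (rsubmx y) -> der_on H g (rsubmx y) DG -> (g (rsubmx y))^T = g (rsubmx y) ->
  \row_k - \sum_a \sum_b
     christoffel (fun z => g (rsubmx z)) y k a b * v 0 a * v 0 b =
  lagrange_force DG v *m invmx (g (rsubmx y)).
Proof.
move=> Hy gD gs; have [lDG _ _] := gD; apply/rowP => k; rewrite !mxE.
pose D (a : 'I_dim) := DG (rsubmx (delta_mx 0 a)).
pose I := invmx (g (rsubmx y)).
(* With row vectors the inverse metric acts from the right, which swaps its indices. *)
have Is l : I l k = I k l.
  by rewrite -[in LHS](_ : I^T = I) ?mxE// /I trmx_inv gs.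
have chr a b : christoffel (fun z => g (rsubmx z)) y k a b =
    2^-1 * \sum_l I k l * (D a b l + D b a l - D l a b).
  rewrite /christoffel; congr (_ * _); apply: eq_bigr => l _.
  by rewrite !(partial_rsubmx _ _ _ Hy gD).
transitivity (- \sum_l I k l * (2^-1 *
   \sum_a \sum_b (D a b l + D b a l - D l a b) * v 0 a * v 0 b)).
  congr (- _).
  transitivity (\sum_a \sum_b \sum_l
      I k l * (2^-1 * ((D a b l + D b a l - D l a b) * v 0 a * v 0 b))).
    apply: eq_bigr => a _; apply: eq_bigr => b _; rewrite chr.
    rewrite mulr_sumr !mulr_suml; apply: eq_bigr => l _.
    by ring.
  under eq_bigr do rewrite exchange_big/=.
  rewrite exchange_big/=; apply: eq_bigr => l _.
  rewrite mulr_sumr [RHS]mulr_sumr; apply: eq_bigr => a _.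
  by rewrite mulr_sumr [RHS]mulr_sumr; apply: eq_bigr => b _.
rewrite -sumrN; apply: eq_bigr => l _; rewrite -/I Is mulrC -mulNr; congr (_ * _).
rewrite mxE.
have -> : \sum_a \sum_b (D a b l + D b a l - D l a b) * v 0 a * v 0 b =
    (v *m DG (rsubmx v)) 0 l + (v *m DG (rsubmx v)) 0 l - (v *m D l *m v^T) 0 0.
  rewrite (sum_force v l lDG) sum_quadratic.
  rewrite [X in _ = _ + X - _]exchange_big/= -big_split -sumrB/=.
  apply: eq_bigr => a _; rewrite -big_split -sumrB/=; apply: eq_bigr => b _.
  by rewrite /D; ring.
by rewrite /D; field.
Qed.

End ChristoffelForce.

Section HessianSymmetry.
Context {R : realType} {n : nat}.
Local Notation E := 'rV[R]_n.+1.

Lemma hessian_sym (u : E -> R) (a v w : E) : c2_at u a ->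
  (w *m \col_k (v *m grad (partial k u) a) 0 0) 0 0 =
  (v *m \col_k (w *m grad (partial k u) a) 0 0) 0 0.
Proof.
move=> [_ _ sym].
have e (v' w' : E) : (w' *m \col_k (v' *m grad (partial k u) a) 0 0) 0 0 =
   \sum_k \sum_l w' 0 k * v' 0 l * partial l (partial k u) a.
  rewrite mxE; apply: eq_bigr => k _; rewrite !mxE mulr_sumr.
  by apply: eq_bigr => l _; rewrite [grad _ _ _ _]mxE mulrA.
rewrite !e exchange_big/=; apply: eq_bigr => k _; apply: eq_bigr => l _.
by rewrite (mulrC (w 0 l)); refine (f_equal2 *%R (erefl _) (sym _ _)).
Qed.

End HessianSymmetry.

(** * Transport of the acceleration *)

Section GeodesicPush.
Context {R : realType} {n : nat} (N : bmanifold R n).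
Local Notation E := 'rV[R]_n.+1.
Local Notation H := (@halfspace R n).
Local Notation dim := (1 + n.+1)%N.

Lemma der_on_rsubmx (V : normedModType R) (A : set V) p q r
    (M DM : V -> 'M[R]_(p, q + r)) a :
  der_on A M a DM -> der_on A (fun z => rsubmx (M z)) a (fun x => rsubmx (DM x)).
Proof.
move=> MD; apply: der_on_mx => i j.
rewrite (_ : (fun z => _) = fun z => M z i (rshift q j)); last first.
  by apply/funext => z; rewrite mxE.
by apply: eq_der_on (der_on_entry i (rshift q j) MD) => x; rewrite mxE.
Qed.

Lemma der_on_lsubmx (V : normedModType R) (A : set V) p q r
    (M DM : V -> 'M[R]_(p, q + r)) a :
  der_on A M a DM -> der_on A (fun z => lsubmx (M z)) a (fun x => lsubmx (DM x)).
Proof.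
move=> MD; apply: der_on_mx => i j.
rewrite (_ : (fun z => _) = fun z => M z i (lshift r j)); last first.
  by apply/funext => z; rewrite mxE.
by apply: eq_der_on (der_on_entry i (lshift r j) MD) => x; rewrite mxE.
Qed.

(** The Hessian matrix at [a] applied to [x], that is, the derivative of [grad u] in the direction
    [x]. *)
Definition hessian (u : E -> R) (a x : E) : 'cV[R]_n.+1 :=
  \col_k (x *m grad (partial k u) a) 0 0.

Definition jac_der (p : nat) (psi : E -> 'rV[R]_p) (a x : E) : 'M[R]_(n.+1, p) :=
  \matrix_(k, l) hessian (fun z => psi z 0 l) a x k 0.

Lemma der_on_grad_hessian u a : c2_at u a -> der_on H (grad u) a (hessian u a).
Proof.
move=> [_ d2u _]; apply: der_on_mx => k l.
rewrite (_ : (fun z => _) = partial k u); last first.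
  by apply/funext => z; rewrite mxE.
by apply: eq_der_on (d2u k) => x; rewrite [RHS]mxE.
Qed.

Lemma der_on_jac_der (p : nat) (psi : E -> 'rV[R]_p) a :
  (forall l, c2_at (fun z => psi z 0 l) a) -> der_on H (jac psi) a (jac_der psi a).
Proof.
move=> psi2; apply: der_on_mx => k l; have [_ d2u _] := psi2 l.
rewrite (_ : (fun z => _) = partial k (fun z => psi z 0 l)); last first.
  by apply/funext => z; rewrite mxE.
by apply: eq_der_on (d2u k) => x; rewrite [RHS]mxE [RHS]mxE.
Qed.

Lemma jac_der_sym (p : nat) (psi : E -> 'rV[R]_p) a (v w : E) :
  (forall l, c2_at (fun z => psi z 0 l) a) ->
  w *m jac_der psi a v = v *m jac_der psi a w.
Proof.
move=> psi2; apply/rowP => l.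
have e (x y : E) : (x *m jac_der psi a y) 0 l =
    (x *m hessian (fun z => psi z 0 l) a y) 0 0.
  by rewrite !mxE; apply: eq_bigr => k _; rewrite [jac_der _ _ _ _ _]mxE.
by rewrite !e; exact: hessian_sym.
Qed.

Section LiftJac.
Variables (f : N -> N) (phi : N -> R).
Hypotheses (cf : c2_map f) (cphi : c2_fun phi).

Definition lift_jac_der (i j : midx N) (a x : E) : 'M[R]_dim :=
  block_mx 0 0 (- hessian (phi \o minv i) a x) (jac_der (local_map f i j) a x).

Lemma der_on_lift_jac i j x : mdom i x -> mdom j (f x) ->
  der_on H (lift_jac f phi i j) (mchart i x) (lift_jac_der i j (mchart i x)).
Proof.
move=> ix jx; apply: der_on_block_mx.
- exact: der_on_cst.
- exact: der_on_cst.
- by apply: der_onN; apply: der_on_grad_hessian; exact: cphi.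
- by apply: der_on_jac_der => l; exact: cf.2.
Qed.

Lemma lift_jac_der_sym i j x (v w : 'rV[R]_dim) : mdom i x -> mdom j (f x) ->
  w *m lift_jac_der i j (mchart i x) (rsubmx v) =
  v *m lift_jac_der i j (mchart i x) (rsubmx w).
Proof.
move=> ix jx; rewrite -{1}(hsubmxK w) -{2}(hsubmxK v) /lift_jac_der.
rewrite !mul_row_block !mulmx0 !add0r; congr row_mx.
  rewrite !mulmxN; congr (- _); apply/matrixP => k l; rewrite !ord1.
  by apply: hessian_sym; exact: cphi.
by apply: jac_der_sym => l; exact: cf.2.
Qed.

Lemma rsubmx_lift_jac i j x (w : 'rV[R]_dim) :
  rsubmx (w *m lift_jac f phi i j (mchart i x)) = rsubmx w *m local_jac f i j x.
Proof.
by rewrite -{1}(hsubmxK w) mul_row_block mulmx0 add0r row_mxKr.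
Qed.

Lemma lift_jac_unit f' i j x : c2_map f' -> cancel f f' -> mdom i x -> mdom j (f x) ->
  lift_jac f phi i j (mchart i x) \in unitmx.
Proof.
move=> cf' fK ix jx; rewrite unitmxE det_lblock det1 mul1r -unitmxE.
by have /mulmx1_unit[] := local_jacK cf cf' fK ix jx.
Qed.

End LiftJac.

Lemma christoffel_stationary h om lam i (p : spacetime N) DG (v : 'rV[R]_dim) :
  @riemannian_metric R n N h -> mdom i p.2 ->
  der_on H (stationary_metric h om lam i \o minv i) (mchart i p.2) DG ->
  \row_k - \sum_a \sum_b
     stationary_christoffel h om lam i (coordM i p) k a b * v 0 a * v 0 b =
  lagrange_force DG v *m invmx (stationary_metric h om lam i p.2).
Proof.
move=> hh ip gD.
have e : rsubmx (coordM i p) = mchart i p.2 by rewrite row_mxKr.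
have := @christoffel_force _ _ (stationary_metric h om lam i \o minv i)
  (coordM i p) DG v.
rewrite e /= mchartK//; apply.
- exact: mchart_halfspace.
- exact: gD.
- exact: stationary_metric_sym.
Qed.

Section Push.
Variables (h h' : midx N -> N -> 'M[R]_n.+1) (om om' : midx N -> N -> 'cV[R]_n.+1)
  (lam lam' : N -> R) (f f' : N -> N) (phi : N -> R).
Hypotheses (hh : riemannian_metric h) (hh' : riemannian_metric h')
  (hom : one_form om) (hlam : c2_fun lam)
  (lam_pos : forall x, 0 < lam x) (lam_pos' : forall x, 0 < lam' x)
  (cf : c2_map f) (cf' : c2_map f') (fK : cancel f f') (cphi : c2_fun phi)
  (h_pull : forall i j x, mdom i x -> mdom j (f x) ->
     h' i x = local_jac f i j x *m h j (f x) *m (local_jac f i j x)^T)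
  (om_pull : forall i j x, mdom i x -> mdom j (f x) ->
     om' i x = local_jac f i j x *m om j (f x) + differential phi i x)
  (lam_pull : forall x, lam' x = lam (f x)).

(** The second summand comes from differentiating [J] along the curve, so the left side is the
    acceleration of the image of a geodesic. Multiplication by the metric turns the claim into an
    equality of forces. *)
Lemma acceleration_push i j (p : spacetime N) (v : 'rV[R]_dim) :
  mdom i p.2 -> mdom j (f p.2) ->
  let J := lift_jac f phi i j (mchart i p.2) in
  (\row_k - \sum_a \sum_b
     stationary_christoffel h' om' lam' i (coordM i p) k a b * v 0 a * v 0 b) *m J
    + v *m lift_jac_der f phi i j (mchart i p.2) (rsubmx v) =
  \row_k - \sum_a \sum_b stationary_christoffel h om lam j
      (coordM j (lift_map f phi p)) k a b * (v *m J) 0 a * (v *m J) 0 b.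
Proof.
move=> ip jp J.
have Ha := mchart_halfspace ip.
have [DG gD] := stationary_metric_der hh hom hlam jp.
have hH := near_local_map_halfspace cf.1 ip jp.
have Jd := der_on_lift_jac cf cphi ip jp.
have psid := c2_map_has_jac cf ip jp.
have gpsi : der_on H (stationary_metric h om lam j \o minv j \o local_map f i j)
    (mchart i p.2) (DG \o (fun x => x *m local_jac f i j p.2)).
  by apply: der_on_comp psid _ hH; rewrite (local_mapE f j ip).
have gD' := der_on_mulmx (der_on_mulmx Jd gpsi) (der_on_tr Jd).
(* The pullback identity holds around the point, so it can be differentiated; this gives the formula
   for [DG'] that [lagrange_transport] expects. *)
have e : \forall z \near mchart i p.2, H z ->
    lift_jac f phi i j z *m
     (stationary_metric h om lam j \o minv j \o local_map f i j) z *m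
     (lift_jac f phi i j z)^T = (stationary_metric h' om' lam' i \o minv i) z.
  apply: filterS (near_minv ip (near_dom cf.1 jp)) => z hz /hz[h1 h2 h3].
  rewrite /= (stationary_metric_pull h_pull om_pull lam_pull h1 h3) h2.
  by rewrite /local_map/= mchartK.
have {}gD' := der_on_near Ha e gD'.
rewrite (christoffel_stationary _ hh' ip gD').
rewrite (@christoffel_stationary h om lam j (lift_map f phi p) DG (v *m J) hh jp gD).
set DG' := (X in lagrange_force X v); rewrite -/DG' in gD'.
have [lDG _ _] := gD; have [lDG' _ _] := gD'.
have Gu := stationary_metric_unit om hh lam_pos jp.
have Gu' := stationary_metric_unit om' hh' lam_pos' ip.
apply: (can_inj (mulmxK Gu)); rewrite mulmxKV//.
have Gpull := stationary_metric_pull h_pull om_pull lam_pull ip jp.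
apply: (@lagrange_transport _ _ _ _ (local_jac f i j p.2) DG DG') => //.
- exact: stationary_metric_sym.
- exact: (lift_jac_unit phi cf cf' fK ip jp).
- by move=> w; exact: rsubmx_lift_jac.
- by move=> xi; rewrite /DG' mulmxDl /= local_mapE// mchartK//.
- by move=> w; exact: lift_jac_der_sym.
- by rewrite -Gpull mulmxKV.
Qed.

End Push.
End GeodesicPush.

(** * Scattering relations *)

Section Scattering.
Context {R : realType} {n : nat} (N : bmanifold R n).
Local Notation E := 'rV[R]_n.+1.
Local Notation H := (@halfspace R n).
Local Notation dim := (1 + n.+1)%N.

Variables (h h' : midx N -> N -> 'M[R]_n.+1) (om om' : midx N -> N -> 'cV[R]_n.+1)
  (lam lam' : N -> R) (f f' : N -> N) (phi : N -> R).
Hypotheses (hh : riemannian_metric h) (hh' : riemannian_metric h')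
  (hom : one_form om) (hlam : c2_fun lam)
  (lam_pos : forall x, 0 < lam x) (lam_pos' : forall x, 0 < lam' x)
  (cf : c2_map f) (cf' : c2_map f') (fK : cancel f f') (f'K : cancel f' f)
  (cphi : c2_fun phi)
  (f_bd : forall x, mboundary x -> f x = x)
  (phi_bd : forall x, mboundary x -> phi x = 0)
  (h_pull : forall i j x, mdom i x -> mdom j (f x) ->
     h' i x = local_jac f i j x *m h j (f x) *m (local_jac f i j x)^T)
  (om_pull : forall i j x, mdom i x -> mdom j (f x) ->
     om' i x = local_jac f i j x *m om j (f x) + differential phi i x)
  (lam_pull : forall x, lam' x = lam (f x)).

Lemma lift_map_continuous : continuous (lift_map f phi).
Proof.
case=> t x.
have c1 : (fun p : spacetime N => p.1 - phi p.2) @ (t, x) --> t - phi x.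
  apply: cvgB; first exact: cvg_fst.
  by apply: (cvg_comp _ phi cvg_snd); exact: c2_fun_continuous.
have c2 : (fun p : spacetime N => f p.2) @ (t, x) --> f x.
  by apply: (cvg_comp _ f cvg_snd); exact: cf.1.
exact: (cvg_pair c1 c2).
Qed.

Lemma near_curve (A : set R) (gam : R -> spacetime N) s (P : N -> Prop) :
  {within A, continuous gam} -> A s -> (\forall x \near (gam s).2, P x) ->
  \forall u \near s, A u -> P (gam u).2.
Proof.
move=> /subspace_continuousP cg As nP.
have nQ : nbhs (gam s) (fun p => P p.2).
  by move: nP; case: (gam s) => t x nP; exact: cvg_snd.
exact: (cg s As _ nQ).
Qed.

Lemma der_on_curve_comp (A : set R) (W : normedModType R) (c : R -> E)
    (g : E -> W) s w L :
  der_on A c s (fun r => r *: w) -> der_on H g (c s) L ->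
  (\forall u \near s, A u -> H (c u)) ->
  der_on A (g \o c) s (fun r => r *: L w).
Proof.
move=> cw gL AH; have [lL _ _] := gL.
by apply: eq_der_on (der_on_comp cw gL AH) => r /=; rewrite (linearZf lL).
Qed.

Lemma geodesic_push L (gam : R -> spacetime N) V :
  geodesic h' om' lam' L gam V ->
  geodesic h om lam L (lift_map f phi \o gam) (fun u => push f phi (gam u) (V u)).
Proof.
move=> [cg eqg]; split.
  apply/subspace_continuousP => s As.
  move/subspace_continuousP: cg => /(_ s As) cg.
  exact: (cvg_comp _ _ cg (@lift_map_continuous (gam s))).
move=> s j s0L jx.
(* The chart [j] around the image is imposed, whereas any chart around the original point will
   do. *)
have ix := chart_at_dom (gam s).2; set i := chart_at _ in ix.
pose A : set R := [set` `[0, L]].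
have As : A s by [].
have nearA : \forall u \near s, A u -> mdom i (gam u).2 /\ mdom j (f (gam u).2).
  apply: (@near_curve A gam s (fun x => mdom i x /\ mdom j (f x)) cg As).
  near=> y; split; near: y; last exact: near_dom cf.1 jx.
  by apply: open_nbhs_nbhs; split=> //; exact: mdom_open.
have [/has_deriv_withinP dy /has_deriv_withinP dy'] := eqg s i s0L ix.
pose zc u := mchart i (gam u).2.
set v := tcoordM i (gam s) (V s) in dy dy'.
have dz : der_on A zc s (fun r => r *: rsubmx v).
  have := der_on_rsubmx dy.
  rewrite (_ : (fun z => _) = zc); last by apply/funext => u; rewrite row_mxKr.
  by apply: eq_der_on => r; rewrite linearZ.
have AH : \forall u \near s, A u -> H (zc u).
  by apply: filterS nearA => u hu /hu[iu _]; exact: mchart_halfspace.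
have Hs := mchart_halfspace ix.
have dphi := der_on_curve_comp dz (c2_has_grad Hs (cphi ix)) AH.
have dpsi := der_on_curve_comp dz (c2_map_has_jac cf ix jx) AH.
have dJ := der_on_curve_comp dz (der_on_lift_jac cf cphi ix jx) AH.
have push_eq u : A u -> mdom i (gam u).2 -> mdom j (f (gam u).2) ->
    tcoordM j (lift_map f phi (gam u)) (push f phi (gam u) (V u)) =
    tcoordM i (gam u) (V u) *m lift_jac f phi i j (zc u).
  by move=> Au iu ju; exact: tcoordM_push.
split; apply/has_deriv_withinP.
  have dt : der_on A (fun u => lsubmx (coordM i (gam u)) - (phi (minv i (zc u)))%:M)
      s (fun r => lsubmx (r *: v) - (r *: rsubmx v) *m grad (phi \o minv i) (zc s)).
    apply: der_onD; first exact: der_on_lsubmx dy.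
    apply: der_onN; apply: der_on_mx => k l; rewrite !ord1.
    rewrite (_ : (fun z => _) = (phi \o minv i) \o zc); last first.
      by apply/funext => u; rewrite !mxE eqxx mulr1n.
    by apply: eq_der_on dphi => r; rewrite -scalemxAl [RHS]mxE.
  apply: (der_on_near As _ (eq_der_on _ (der_on_row_mx dt dpsi))).
    apply: filterS nearA => u hu /hu[iu ju].
    rewrite /coordM/= row_mxKl mchartK//; congr row_mx; last first.
      by rewrite /local_map/= mchartK.
    by apply/matrixP => k l; rewrite !ord1 !mxE eqxx !mulr1n.
  have vJ : v *m lift_jac f phi i j (zc s) = row_mx
      (lsubmx v - rsubmx v *m grad (phi \o minv i) (zc s))
      (rsubmx v *m jac (local_map f i j) (zc s)).
    by rewrite -{1}(hsubmxK v) mul_row_block mulmx1 mulmx0 add0r mulmxN.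
  move=> r; rewrite push_eq// -/v vJ [RHS]scale_row_mx scalerBr -scalemxAl.
  by rewrite [lsubmx (r *: v)]linearZ.
rewrite (push_eq s As ix jx).
have <- := @acceleration_push R n N h h' om om' lam lam' f f' phi hh hh' hom hlam
  lam_pos lam_pos' cf cf' fK cphi h_pull om_pull lam_pull i j (gam s) v ix jx.
(* The product rule for the velocity times [J] along the curve produces the left side of
   [acceleration_push]. *)
apply: (der_on_near As _ (eq_der_on _ (der_on_mulmx dy' dJ))).
  by apply: filterS nearA => u hu Au; have [iu ju] := hu Au; rewrite push_eq.
by move=> r; rewrite scalerDr -scalemxAl -scalemxAr.
Unshelve. all: by end_near. Qed.

Lemma gform_push (p : spacetime N) v w :
  gform h om lam (lift_map f phi p) (push f phi p v) (push f phi p w) =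
  gform h' om' lam' p v w.
Proof.
have ix := chart_at_dom p.2; have jx := chart_at_dom (f p.2).
rewrite /gform !push_row (stationary_metric_pull h_pull om_pull lam_pull ix jx).
by rewrite trmx_mul !mulmxA.
Qed.

Lemma push_partial_t (p : spacetime N) : push f phi p partial_t = partial_t.
Proof. by rewrite /push /partial_t/= !mul0mx mxE subr0. Qed.

Lemma lift_map_boundary (p : spacetime N) : mboundary p.2 -> lift_map f phi p = p.
Proof. by case: p => t x /= bx; rewrite /lift_map/= phi_bd// f_bd// subr0. Qed.

(** At a boundary point [f x = x] also makes the preferred charts at both ends the same, so that
    components can be compared. *)
Lemma push_tangent (p : spacetime N) v : mboundary p.2 -> tangent_to_boundary v.2 ->
  push f phi p v = v.
Proof.
case: p v => t x [tau xi] /= bx t0; have ix := chart_at_dom x.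
by rewrite /push/= f_bd// local_jac_tangent// differential_tangent// subr0.
Qed.

Lemma pushB (p : spacetime N) v w :
  push f phi p (v.1 - w.1, v.2 - w.2) =
  ((push f phi p v).1 - (push f phi p w).1, (push f phi p v).2 - (push f phi p w).2).
Proof.
rewrite /push/= !mulmxBl [(_ - _ : 'M[R]_1) 0 0]mxE [(- _ : 'M[R]_1) 0 0]mxE.
by congr pair; ring.
Qed.

(** Both [v'] and the test vectors are tangent to the boundary, hence fixed by [push], which
    preserves orthogonality. *)
Lemma boundary_projection_push (p : spacetime N) v v' : mboundary p.2 ->
  boundary_projection h' om' lam' p v v' ->
  boundary_projection h om lam p (push f phi p v) v'.
Proof.
move=> bp [t0 orth]; split=> // w w0.
have := orth w w0; rewrite -gform_push pushB lift_map_boundary//.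
by rewrite (push_tangent bp t0) (push_tangent bp w0).
Qed.

Lemma scattering_sub rho m :
  scattering h' om' lam' rho m `<=` scattering h om lam rho m.
Proof.
move=> [[p v'] [q w']] /= [v [L [gam [V [[bp nv mv iv pv] [[L0 geo g0 V0] [gL bq gbd pw]]]]]]].
exists (push f phi p v), L, (lift_map f phi \o gam), (fun u => push f phi (gam u) (V u)).
have Fp := lift_map_boundary bp; have Fq := lift_map_boundary bq.
have gp v1 v2 : gform h om lam p (push f phi p v1) (push f phi p v2) =
    gform h' om' lam' p v1 v2 by rewrite -gform_push Fp.
split; [split|split; split] => //.
- by rewrite gp.
(* The momentum is kept because [push] preserves the Killing field. *)
- by rewrite -(push_partial_t p) gp.
- rewrite /push/= f_bd//.
  exact: (local_jac_inward cf f_bd cf' fK f'K bp (chart_at_dom _) iv).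
- exact: boundary_projection_push.
- exact: geodesic_push.
- by rewrite /= g0.
- by rewrite g0 V0.
- by rewrite /= gL.
(* If [f x] lies on the boundary then [f (f x) = f x], and injectivity gives [f x = x]: the image
   cannot meet the boundary earlier than the original curve. *)
- move=> s s0L /= bs; apply: (gbd s s0L).
  by have := f_bd bs => /(can_inj fK) e; rewrite -e.
- by rewrite gL; exact: boundary_projection_push.
Qed.

End Scattering.

(** * Pullbacks in arbitrary target charts *)

Section PullbackCharts.
Context {R : realType} {n : nat} (N : bmanifold R n).
Variables (f : N -> N) (cf : c2_map f).

Lemma pullback_metricE (h : midx N -> N -> 'M[R]_n.+1) i j x :
  riemannian_metric h -> mdom i x -> mdom j (f x) ->
  pullback_metric f h i x = local_jac f i j x *m h j (f x) *m (local_jac f i j x)^T.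
Proof.
move=> [hT _ _ _] ix jx; have cx := chart_at_dom (f x).
have -> : local_jac f i j x = map_jac f i x *m transition_jac (chart_at (f x)) j (f x).
  exact: (local_jac_comp cf (c2_map_id N) ix cx jx).
rewrite trmx_mul.
by rewrite /pullback_metric (hT _ _ _ cx jx) !mulmxA.
Qed.

Lemma pullback_formE (om : midx N -> N -> 'cV[R]_n.+1) i j x :
  one_form om -> mdom i x -> mdom j (f x) ->
  pullback_form f om i x = local_jac f i j x *m om j (f x).
Proof.
move=> [oT _] ix jx; have cx := chart_at_dom (f x).
have -> : local_jac f i j x = map_jac f i x *m transition_jac (chart_at (f x)) j (f x).
  exact: (local_jac_comp cf (c2_map_id N) ix cx jx).
by rewrite /pullback_form (oT _ _ _ cx jx) mulmxA.
Qed.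

End PullbackCharts.

Theorem mainTheorem3 (R : realType) (n : nat) (N : bmanifold R n)
  (hN : compact [set: N]) (m : R) (hm : 0 < m)
  (h h' : midx N -> N -> 'M[R]_n.+1)
  (om om' : midx N -> N -> 'cV[R]_n.+1)
  (lam lam' : N -> R)
  (hh : riemannian_metric h) (hh' : riemannian_metric h')
  (hom : one_form om) (hom' : one_form om')
  (hlam : smooth_fun lam) (hlam' : smooth_fun lam')
  (hlam_pos : forall x, 0 < lam x) (hlam_pos' : forall x, 0 < lam' x)
  (hbd_h : forall i x, mdom i x -> mboundary x -> h i x = h' i x)
  (hbd_om : forall x xi, mboundary x -> tangent_to_boundary xi ->
     pairing om x xi = pairing om' x xi)
  (hbd_lam : forall x, mboundary x -> lam x = lam' x)
  (f : N -> N) (hf : diffeomorphism f)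
  (hf_bd : forall x, mboundary x -> f x = x)
  (phi : N -> R) (hphi : smooth_fun phi)
  (hphi_bd : forall x, mboundary x -> phi x = 0)
  (h_pull : forall i x, mdom i x -> h' i x = pullback_metric f h i x)
  (om_pull : forall i x, mdom i x ->
     om' i x = pullback_form f om i x + differential phi i x)
  (lam_pull : forall x, (lam' x)^-1 = (lam (f x))^-1) :
  forall rho : R, (forall x, lam x < rho ^+ 2 / m ^+ 2) ->
    scattering h om lam rho m = scattering h' om' lam' rho m.
Proof.
move=> rho _.
have [/smooth_map_c2 cf [f' [/smooth_map_c2 cf' fK f'K]]] := hf.
have cphi := smooth_fun_c2 hphi.
have h_pullE i j x (ix : mdom i x) (jx : mdom j (f x)) :
    h' i x = local_jac f i j x *m h j (f x) *m (local_jac f i j x)^T.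
  by rewrite h_pull// (pullback_metricE cf hh ix jx).
have om_pullE i j x (ix : mdom i x) (jx : mdom j (f x)) :
    om' i x = local_jac f i j x *m om j (f x) + differential phi i x.
  by rewrite om_pull// (pullback_formE cf hom ix jx).
have lam_pullE x : lam' x = lam (f x) by apply: invr_inj.
have f'_bd x : mboundary x -> f' x = x by move=> /hf_bd e; rewrite -{1}e fK.
have cpsi := c2_fun_comp cf' cphi.
pose psi x := - phi (f' x).
have jacK i j x : mdom i x -> mdom j (f' x) ->
    local_jac f' i j x *m local_jac f j i (f' x) = 1%:M.
  exact: local_jacK cf' cf f'K.
apply/seteqP; split; last first.
  exact: (scattering_sub hh hh' hom (smooth_fun_c2 hlam) hlam_pos hlam_pos'
    cf cf' fK f'K cphi hf_bd hphi_bd h_pullE om_pullE lam_pullE).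
apply: (@scattering_sub _ _ N h' h om' om lam' lam f' f psi hh' hh hom'
  (smooth_fun_c2 hlam') hlam_pos' hlam_pos cf' cf f'K fK (c2_funN cpsi) f'_bd).
- by move=> x bx; rewrite /psi f'_bd// hphi_bd// oppr0.
- move=> i j x ix jx.
  rewrite (h_pullE j i (f' x) jx) ?f'K// !mulmxA jacK// mul1mx.
  by rewrite -mulmxA -trmx_mul jacK// trmx1 mulmx1.
(* Pulling [om'] back by [f'] gives [om] plus the pullback of [d phi]; the differential of [psi] is
   minus that exact term. *)
- move=> i j x ix jx.
  rewrite (om_pullE j i (f' x) jx) ?f'K// mulmxDr mulmxA jacK// mul1mx.
  rewrite (differentialN cpsi ix) (differential_comp cf' cphi ix jx).
  by rewrite addrK.
- by move=> x; rewrite lam_pullE f'K.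
Qed.
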